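(* Let $(a_k)_{k\in\mathbb{N}}$ be a sequence with $a_k>0$ for all $k\in\mathbb{N}$, and let $\check{\mathcal{E}}$ be the trace of the Bessel Dirichlet form $\mathcal{E}$ (case $n=3$) with respect to $\mu=\sum_{k\in\mathbb{N}}a_k\delta_k$. Then $\check{\mathcal{E}}$ is irreducible and transient.
   Context: $\mathbb{N}=\{1,2,\dots\}$ and $I=(0,\infty)$; $AC(I)$ denotes the (locally) absolutely continuous functions on $I$. Let $dm=2x^2\,dx$ on $I$. The Bessel Dirichlet form (case $n=3$) is the form in $L^2(I,m)$ with $$\mathcal{D}=\{u\in AC(I)\cap L^2(I,m):\ \int_0^\infty (u')^2x^2\,dx<\infty\},\qquad \mathcal{E}[u]=\int_0^\infty (u'(x))^2x^2\,dx .$$ For $\lambda>0$, $\mathcal{E}_\lambda[u]=\mathcal{E}[u]+\lambda\int_I u^2\,dm$. Trace with respect to $\mu=\sum_{k\in\mathbb{N}}a_k\delta_k$: $\ell^2(\mathbb{N},\mu)=L^2(\mathbb{N},\mu)$ is the space of real sequences with $\sum_k a_ku_k^2<\infty$. Let $D(J)=\{u\in\mathcal{D}:\sum_{k}a_ku(k)^2<\infty\}$ and $J:D(J)\to\ell^2(\mathbb{N},\mu)$, $Ju=u|_{\mathbb{N}}$. For $\lambda>0$ let $P_\lambda$ be the orthogonal projection in $(\mathcal{D},\mathcal{E}_\lambda)$ onto the $\mathcal{E}_\lambda$-orthogonal complement of $\ker J=\{u\in\mathcal{D}:u(k)=0\ \forall k\in\mathbb{N}\}$, and set $\check{\mathcal{E}}_\lambda[Ju]:=\mathcal{E}_\lambda[P_\lambda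 u]$ for $u\in D(J)$. Each $\check{\mathcal{E}}_\lambda$ is a closed form in $\ell^2(\mathbb{N},\mu)$ with domain $\operatorname{ran}J$, and the family is monotone increasing in $\lambda$. The trace form $\check{\mathcal{E}}$, with domain $\check{\mathcal{D}}$, is by definition the Mosco limit of $\check{\mathcal{E}}_\lambda$ as $\lambda\downarrow0$; it is a Dirichlet form in $\ell^2(\mathbb{N},\mu)$. Irreducible: if $Y\subset\mathbb{N}$ is invariant for the associated semigroup $\check T_t$ (i.e. $\check T_t(\mathbf 1_Yf)=\mathbf 1_Y\check T_tf$ for all $f\in\ell^2(\mathbb{N},\mu)$, $t>0$), then $Y=\emptyset$ or $Y=\mathbb{N}$. Transient: there is a bounded $g\in\ell^1(\mathbb{N},\mu)$, $g>0$ everywhere, with $\int_{\mathbb{N}}|u|g\,d\mu\le\sqrt{\check{\mathcal{E}}[u]}$ for all $u\in\check{\mathcal{D}}$. *)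

(* Defs.v *)
From HB Require Import structures.
From mathcomp Require Import all_boot all_order all_algebra.
From mathcomp Require Import all_classical all_reals all_analysis.

Set Implicit Arguments.
Unset Strict Implicit.
Unset Printing Implicit Defensive.

Import Order.TTheory GRing.Theory Num.Theory.
Import numFieldNormedType.Exports.

Local Open Scope classical_set_scope.
Local Open Scope ring_scope.

(* Functions on I = (0, +oo) are represented by functions R -> R whose values
   outside I are never used.  Functions on the positive integers are
   represented by sequences nat -> R in which index k stands for the integer
   k + 1; in particular [a k] is the weight of the point k + 1. *)

Section BesselForm.
Context {R : realType}.
Implicit Types (u v w p : R -> R) (lam : R).

Definition halfline : set R := `]0, +oo[.

Definition abs_continuous_on (lo hi : R) u : Prop :=
  forall eps : R, 0 < eps -> exists2 delta : R, 0 < delta &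
    forall (n : nat) (x y : 'I_n -> R),
      (forall i, lo <= x i /\ x i <= y i /\ y i <= hi) ->
      (forall i j, i != j -> y i <= x j \/ y j <= x i) ->
      \sum_(i < n) (y i - x i) < delta ->
      \sum_(i < n) `|u (y i) - u (x i)| < eps.

Definition loc_abs_continuous u : Prop :=
  forall lo hi : R, 0 < lo -> lo <= hi -> abs_continuous_on lo hi u.

(* The classical derivative exists almost everywhere on I for u in AC(I). *)
Definition bessel_dom : set (R -> R) :=
  [set u | [/\ loc_abs_continuous u,
     (\int[lebesgue_measure]_(x in halfline) (u x ^+ 2 * (2 * x ^+ 2))%:E
        < +oo)%E &
     (\int[lebesgue_measure]_(x in halfline) (derive1 u x ^+ 2 * x ^+ 2)%:E
        < +oo)%E]].

Definition bessel_form u v : R :=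
  \int[lebesgue_measure]_(x in halfline) (derive1 u x * derive1 v x * x ^+ 2).

Definition bessel_inner u v : R :=
  \int[lebesgue_measure]_(x in halfline) (u x * v x * (2 * x ^+ 2)).

Definition bessel_form_shift lam u v : R :=
  bessel_form u v + lam * bessel_inner u v.

Definition restrN u : nat -> R := fun k => u k.+1%:R.

Definition kerJ : set (R -> R) :=
  [set u | bessel_dom u /\ forall k, restrN u k = 0].

Definition orth_compl lam (S : set (R -> R)) : set (R -> R) :=
  [set u | bessel_dom u /\ forall w, S w -> bessel_form_shift lam u w = 0].

Definition is_orth_proj lam (M : set (R -> R)) u p : Prop :=
  M p /\ forall w, M w -> bessel_form_shift lam (fun x => u x - p x) w = 0.

End BesselForm.

Section SequenceSpace.
Context {R : realType}.
Implicit Types (a f g u v : nat -> R).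

Definition l2sq a u : \bar R := (\sum_(0 <= k <oo) (a k * u k ^+ 2)%:E)%E.

Definition l2 a : set (nat -> R) := [set u | (l2sq a u < +oo)%E].

Definition l2inner a u v : R := limn (series (fun k => a k * u k * v k)).

Definition l2_weak_cvg a (un : nat -> nat -> R) u : Prop :=
  forall v, l2 a v -> (fun n => l2inner a (un n) v) @ \oo --> l2inner a u v.

Definition l2_strong_cvg a (un : nat -> nat -> R) u : Prop :=
  (fun n => l2sq a (fun k => un n k - u k)) @ \oo --> 0%E.

(* A quadratic form in l^2(mu) is a functional with values in the extended
   reals, equal to +oo off its domain. *)
Definition form_dom a (E : (nat -> R) -> \bar R) : set (nat -> R) :=
  [set u | l2 a u /\ (E u < +oo)%E].

Definition form_polar (E : (nat -> R) -> \bar R) u v : R :=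
  (fine (E (fun k => u k + v k)) - fine (E (fun k => u k - v k))) / 4.

Definition mosco_cvg a (En : nat -> (nat -> R) -> \bar R)
    (E : (nat -> R) -> \bar R) : Prop :=
  (forall un u, (forall n, l2 a (un n)) -> l2 a u -> l2_weak_cvg a un u ->
     (E u <= limn_einf (fun n => En n (un n)))%E) /\
  (forall u, l2 a u -> exists un, [/\ forall n, l2 a (un n),
     l2_strong_cvg a un u &
     (limn_esup (fun n => En n (un n)) <= E u)%E]).

(* T is the strongly continuous contraction semigroup on l^2(mu) whose
   generator is -A, where A is the operator associated with E, i.e.,
   f \in dom A and A f = g iff f \in dom E and E(f, v) = <g, v> for all
   v \in dom E. *)
Definition semigroup_of a (E : (nat -> R) -> \bar R)
    (T : R -> (nat -> R) -> nat -> R) : Prop :=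
  [/\ (forall t f, 0 < t -> l2 a f ->
         l2 a (T t f) /\ (l2sq a (T t f) <= l2sq a f)%E),
      (forall t c f g, 0 < t -> l2 a f -> l2 a g ->
         T t (fun k => c * f k + g k) = (fun k => c * T t f k + T t g k)),
      (forall s t f, 0 < s -> 0 < t -> l2 a f -> T (s + t) f = T s (T t f)),
      (forall f, l2 a f ->
         l2sq a (fun k => T t f k - f k) @[t --> 0^'+] --> 0%E) &
      (forall f g, l2 a f -> l2 a g ->
         l2sq a (fun k => (f k - T t f k) / t - g k) @[t --> 0^'+] --> 0%E <->
         form_dom a E f /\
         forall v, form_dom a E v -> form_polar E f v = l2inner a g v)].

Definition invariant_set a (T : R -> (nat -> R) -> nat -> R) (Y : set nat) :
    Prop :=
  forall t f, 0 < t -> l2 a f ->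
    T t (fun k => \1_Y k * f k) = (fun k => \1_Y k * T t f k).

Definition irreducible_form a (E : (nat -> R) -> \bar R) : Prop :=
  forall T, semigroup_of a E T ->
  forall Y : set nat, invariant_set a T Y -> Y = set0 \/ Y = setT.

Definition transient_form a (E : (nat -> R) -> \bar R) : Prop :=
  exists g : nat -> R,
    [/\ forall k, 0 < g k,
        exists M : R, forall k, g k <= M,
        (\sum_(0 <= k <oo) (a k * g k)%:E < +oo)%E &
        forall u, form_dom a E u ->
          (\sum_(0 <= k <oo) (a k * (`|u k| * g k))%:E
             <= (Num.sqrt (fine (E u)))%:E)%E].

End SequenceSpace.

Section Trace.
Context {R : realType}.
Implicit Types (a v : nat -> R) (lam : R).

Definition domJ a : set (R -> R) :=
  [set u | bessel_dom u /\ l2 a (restrN u)].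

(* The infimum only selects a value: the set is the singleton
   {E_lam[P_lam u]} for v = J u, and empty, giving +oo, for v outside ran J. *)
Definition trace_shift a lam v : \bar R :=
  ereal_inf [set e | exists u p,
    [/\ domJ a u, restrN u = v,
        is_orth_proj lam (orth_compl lam kerJ) u p &
        e = (bessel_form_shift lam p p)%:E]].

Definition is_trace_form a (E : (nat -> R) -> \bar R) : Prop :=
  forall lam : nat -> R, (forall n, 0 < lam n) -> lam @ \oo --> 0 ->
    mosco_cvg a (fun n => trace_shift a (lam n)) E.

End Trace.

(* Main.v *)
Require Import Defs.
From HB Require Import structures.
From mathcomp Require Import all_boot all_order all_algebra.
From mathcomp Require Import all_classical all_reals all_analysis.
From mathcomp Require Import measurable_realfun ring lra.
Import Order.TTheory GRing.Theory Num.Theory.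
Import numFieldNormedType.Exports.
Local Open Scope ring_scope.

(** The trace form is never computed on its whole domain.  All that is used of it
is how it reacts to changing one entry of a sequence, and a pointwise bound.

Let lam = K^2 / 2.  A function f / x solves the Euler-Lagrange equation of the
shifted form E_lam between consecutive integers iff f'' = K^2 f.  Hence, for
every integer k >= 1, the tent
  tent x = (k / x) * sinh (K t) / sinh K,   t = max (0, 1 - |x - k|),
which is 1 at k and 0 at all other integers, is E_lam-orthogonal to the
functions vanishing on the integers.  Integrating by parts over the two sides
of k gives, for every z in the domain ([tent_form]),
  E_lam (z, tent) = 2 k^2 C z(k) - k (k-1) S z(k-1) - k (k+1) S z(k+1)
with C = K coth K and S = K / sinh K, both of which tend to 1 as K tends to 0.
Besides this formula the proof needs the bound |z(x)| <= sqrt (E[z] / x)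
([bessel_pointwise]), a Cauchy-Schwarz inequality for functions that vanish at
infinity.

Three things follow.

The projection p of u has the values of u at the integers
([orth_proj_restrN]): z = u - p is orthogonal to all tents, so k z(k)
satisfies a three-term recursion whose solutions grow at least linearly unless
they are zero, whereas z(k) tends to 0.  Therefore a sequence v satisfies
v(k)^2 <= E_lam-trace of v, with a constant that does not depend on lam.

Adding a multiple of the k-th unit sequence to v adds the same multiple of a
tent to p, so the traces of E_lam change by an explicit amount.  This passes
to the Mosco limit, first as an inequality along a recovery sequence and then,
undoing the change, as an equality ([trace_form_perturbE]).  So the k-th unit
sequence e is in the domain of the operator A of the form, and A e has
the nonzero entries - k (k-1) / a and - k (k+1) / a next to k.  If an invariant
set contained exactly one of two neighbours, then T_t e would vanish at the
other neighbour for all t, and so would A e, which is absurd: the form is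
irreducible.

The bound v(k)^2 <= trace of v also passes to the limit and gives
transience, with g(k) = 2^-k / (1 + a(k)).

The analytic tool behind the integrations by parts is the fundamental theorem
of calculus for absolutely continuous functions.  The variation of such a
function is absolutely continuous, so the function is a difference of
nondecreasing ones; the Stieltjes measure of each of these is dominated by
Lebesgue measure ([stieltjes_dominated]), and its Radon-Nikodym density is the
derivative at all Lebesgue points. *)

Set Implicit Arguments.
Unset Strict Implicit.
Unset Printing Implicit Defensive.
Local Open Scope classical_set_scope.

(** * Absolute continuity and total variation *)

Section AbsCont.
Context {R : realType}.
Implicit Types (lo hi a b x y : R) (u w : R -> R).

(** An interval is the pair of its endpoints; two of them may touch. *)
Definition nonoverlap (p q : R * R) : bool := (p.2 <= q.1) || (q.2 <= p.1).

Definition within_itv lo hi (p : R * R) : bool :=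
  [&& lo <= p.1, p.1 <= p.2 & p.2 <= hi].

Lemma within_itvP {lo hi p} :
  reflect [/\ lo <= p.1, p.1 <= p.2 & p.2 <= hi] (within_itv lo hi p).
Proof. exact: and3P. Qed.

(** Lists of intervals, unlike families indexed by ordinals, are easily
refined by replacing an interval by the pieces of a partition. *)
Lemma abs_continuous_onP lo hi u : abs_continuous_on lo hi u <->
  forall eps : R, 0 < eps -> exists2 delta : R, 0 < delta &
    forall s : seq (R * R), all (within_itv lo hi) s -> pairwise nonoverlap s ->
      \sum_(p <- s) (p.2 - p.1) < delta ->
      \sum_(p <- s) `|u p.2 - u p.1| < eps.
Proof.
split=> ac eps e0; have [d d0 dP] := ac _ e0; exists d => //.
- move=> s /allP swi spw; rewrite !(big_nth (0, 0)) !big_mkord => sd.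
  apply: (dP (size s) (fun i => (nth (0, 0) s i).1)
             (fun i => (nth (0, 0) s i).2)) => //.
    by move=> i; have /within_itvP[] := swi _ (mem_nth (0, 0) (ltn_ord i)).
  move=> i j; rewrite neq_ltn => /orP[] ij.
    by have /orP := pairwiseP (0, 0) spw i j (ltn_ord _) (ltn_ord _) ij.
  have /orP := pairwiseP (0, 0) spw j i (ltn_ord _) (ltn_ord _) ij.
  by move=> []; [right|left].
move=> n x y xy dis sd.
pose s := [seq (x i, y i) | i <- enum 'I_n].
have E (F : R * R -> R) : \sum_(p <- s) F p = \sum_(i < n) F (x i, y i).
  by rewrite big_map -big_enum.
have := dP s; rewrite !E; apply => //.
- apply/allP => p /mapP[i _ ->]; have [? [? ?]] := xy i.
  by apply/within_itvP.
- rewrite pairwise_map; have : uniq (enum 'I_n) by exact: enum_uniq.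
  rewrite uniq_pairwise; apply: sub_pairwise => i j /= ij; apply/orP.
  exact: dis.
Qed.

Lemma abs_continuous_onDZ lo hi (c d : R) u w :
  abs_continuous_on lo hi u -> abs_continuous_on lo hi w ->
  abs_continuous_on lo hi (fun x => c * u x + d * w x).
Proof.
move=> acu acw eps e0; pose M := `|c| + `|d| + 1.
have M0 : 0 < M by rewrite ltr_wpDl// addr_ge0.
have e0' : 0 < eps / M / 2 by rewrite !divr_gt0.
have [d1 d10 d1P] := acu _ e0'; have [d2 d20 d2P] := acw _ e0'.
exists (Num.min d1 d2); first by rewrite lt_min d10.
move=> n x y xy dis; rewrite lt_min => /andP[s1 s2].
have h1 := d1P n x y xy dis s1; have h2 := d2P n x y xy dis s2.
have -> : eps = M * (eps / M / 2 + eps / M / 2).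
  by field; rewrite gt_eqF.
apply: le_lt_trans (_ : _ <= M * (\sum_(i < n) `|u (y i) - u (x i)| +
  \sum_(i < n) `|w (y i) - w (x i)|)) _; last first.
  by rewrite ltr_pM2l// ltrD.
rewrite -big_split/= mulr_sumr; apply: ler_sum => i _.
have -> : c * u (y i) + d * w (y i) - (c * u (x i) + d * w (x i)) =
  c * (u (y i) - u (x i)) + d * (w (y i) - w (x i)) by ring.
rewrite (le_trans (ler_normD _ _))// !normrM mulrDr lerD// ler_wpM2r//.
  by rewrite /M -addrA lerDl addr_ge0.
by rewrite /M addrAC lerDr addr_ge0.
Qed.

Lemma lipschitz_abs_continuous_on lo hi (K : R) u :
  (forall x y, lo <= x -> x <= y -> y <= hi -> `|u y - u x| <= K * (y - x)) ->
  abs_continuous_on lo hi u.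
Proof.
move=> uK eps e0; pose M := `|K| + 1.
have M0 : 0 < M by rewrite ltr_wpDl.
exists (eps / M); first by rewrite divr_gt0.
move=> n x y xy _; rewrite ltr_pdivlMr// mulrC; apply: le_lt_trans.
rewrite mulr_sumr; apply: ler_sum => i _; have [lx [xy' yh]] := xy i.
rewrite (le_trans (uK _ _ lx xy' yh))// ler_wpM2r ?subr_ge0//.
by rewrite (le_trans (ler_norm _))// lerDl.
Qed.

(** The pieces of a partition are listed by zipping it with its shift; together
they are an admissible family of the same total length. *)
Lemma partition_pairs a (t : seq R) : path <%R a t ->
  [/\ all (within_itv a (last a t)) (zip (a :: t) t),
      pairwise nonoverlap (zip (a :: t) t) &
      \sum_(p <- zip (a :: t) t) (p.2 - p.1) = last a t - a].
Proof.
elim: t a => [a _|b t ih a /= /andP[ab bt]]; first by rewrite big_nil subrr.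
have [ih1 ih2 ih3] := ih _ bt.
have blast : b <= last b t.
  by apply: (@itv_partition_le _ _ _ _ t); split.
rewrite big_cons ih3/=.
split; last by ring.
- apply/andP; split; first by apply/within_itvP; split => //; exact: ltW.
  apply: sub_all ih1 => p /within_itvP[bp ? ?]; apply/within_itvP; split => //.
  exact: le_trans (ltW ab) bp.
- apply/andP; split => //; apply/allP => p /(allP ih1)/within_itvP[bp _ _].
  by rewrite /nonoverlap/= bp.
Qed.

Lemma variation_pairs a b u (t : seq R) : itv_partition a b t ->
  variation a b u t = \sum_(p <- zip (a :: t) t) `|u p.2 - u p.1|.
Proof.
move=> /[dup] abt /variation_zip ->.
have: forall (s1 s2 : seq R), \sum_(x <- zip s1 s2) `|u x.1 - u x.2| =
  \sum_(x <- zip s2 s1) `|u x.2 - u x.1|.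
  elim=> [|x s1 ih] [|y s2] //=; rewrite ?big_nil// !big_cons ih//.
by move=> ->.
Qed.


Lemma nonoverlap_sub a b (p q : R * R) : within_itv a b q ->
  nonoverlap (a, b) p -> nonoverlap q p.
Proof.
move=> /within_itvP[aq _ qb] /orP[]/= ab; apply/orP; [left|right].
  exact: le_trans ab.
exact: le_trans aq.
Qed.

Lemma nonoverlapC (p q : R * R) : nonoverlap p q = nonoverlap q p.
Proof. by rewrite /nonoverlap orbC. Qed.

(** Partitioning the intervals of a family changes neither its admissibility nor
its total length, so a bound for the sums of increments holds for the suprema
over partitions.  The intervals are partitioned one by one; [acc] collects the
pieces. *)
Lemma sum_total_variation_le lo hi u (eps delta : R) :
  (forall s, all (within_itv lo hi) s -> pairwise nonoverlap s ->
      \sum_(p <- s) (p.2 - p.1) < delta ->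
      \sum_(p <- s) `|u p.2 - u p.1| <= eps) ->
  forall s acc, all (within_itv lo hi) (acc ++ s) ->
    pairwise nonoverlap (acc ++ s) ->
    \sum_(p <- acc ++ s) (p.2 - p.1) < delta ->
    ((\sum_(p <- acc) `|u p.2 - u p.1|)%:E +
     \sum_(p <- s) total_variation p.1 p.2 u <= eps%:E)%E.
Proof.
move=> ac; elim=> [|[a b] s ih] acc.
  rewrite cats0 big_nil adde0 lee_fin; exact: ac.
rewrite all_cat pairwise_cat big_cat/= => /and3P[wacc wab ws].
rewrite allrel_consr -/(pairwise _ _) => /and3P[/andP[oab oacc] pacc].
rewrite -/(pairwise _ _) => /andP[abs ps].
rewrite big_cons/= => sd.
have [/= loa ab bhi] := within_itvP wab.
have step t : itv_partition a b t ->
    ((\sum_(p <- acc) `|u p.2 - u p.1| + variation a b u t)%:E +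
     \sum_(p <- s) total_variation p.1 p.2 u <= eps%:E)%E.
  move=> /[dup] abt [at_ /eqP tb].
  have [wt pt st] := partition_pairs at_; rewrite tb in wt st.
  rewrite (variation_pairs u abt) -big_cat/=; apply: ih.
  - rewrite -catA !all_cat wacc ws andbT/=.
    apply: sub_all wt => q /within_itvP[aq qq qb]; apply/within_itvP.
    by split => //; [exact: le_trans aq|exact: le_trans bhi].
  - rewrite -catA !pairwise_cat pacc pt ps !andbT allrel_catr oacc andbT.
    apply/andP; split; apply/allrelP => q r.
      move=> qacc /(allP wt) rab; rewrite nonoverlapC.
      apply: nonoverlap_sub rab _; rewrite nonoverlapC.
      exact: (allP oab).
    by move=> /(allP wt) qab /(allP abs); exact: nonoverlap_sub.
  - by rewrite -catA !big_cat/= st.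
have S0 : (0 <= \sum_(p <- s) total_variation p.1 p.2 u)%E.
  rewrite big_seq; apply: sume_ge0 => p /(allP ws)/within_itvP[_ ? _].
  exact: total_variation_ge0.
have Sfin : (\sum_(p <- s) total_variation p.1 p.2 u)%E \is a fin_num.
  rewrite ge0_fin_numE//.
  have [t abt] : exists t, itv_partition a b t.
    move: ab; rewrite le_eqVlt => /orP[/eqP ->|ab].
      by exists [::]; split => /=.
    by exists [:: b]; exact: itv_partition1.
  have := step _ abt; rewrite -leeBrDl// => /le_lt_trans; apply.
  by rewrite -EFinB ltry.
rewrite big_cons/= addeCA -leeBrDr; last by rewrite fin_numD/= Sfin.
apply: ge_ereal_sup => _ [_ [t abt <-] <-].
rewrite leeBrDr; last by rewrite fin_numD/= Sfin.
by rewrite addeA -EFinD [(variation _ _ _ _ + _)%R]addrC; exact: step.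
Qed.

(** The variation is at most 1 on the intervals that are shorter than the delta
of epsilon = 1, and finitely many of them cover [lo, hi]. *)
Lemma abs_continuous_on_TV_fin lo hi u : abs_continuous_on lo hi u ->
  lo <= hi -> total_variation lo hi u \is a fin_num.
Proof.
move=> /abs_continuous_onP/(_ 1 ltr01)[d d0 ac] lohi.
have {}ac s : all (within_itv lo hi) s -> pairwise nonoverlap s ->
      \sum_(p <- s) (p.2 - p.1) < d ->
      \sum_(p <- s) `|u p.2 - u p.1| <= 1.
  by move=> s1 s2 s3; exact/ltW/ac.
have small x y : lo <= x -> x <= y -> y <= hi -> y - x < d ->
    total_variation x y u \is a fin_num.
  move=> lox xy yhi yx; rewrite ge0_fin_numE ?total_variation_ge0//.
  have := sum_total_variation_le ac (s := [:: (x, y)]) (acc := [::]).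
  rewrite /= !big_seq1 big_nil add0e => H.
  apply: le_lt_trans (H _ _ _) _ => //; last by rewrite ltry.
  by rewrite andbT; apply/within_itvP.
have main n : forall x, lo <= x -> x <= hi -> x - lo <= n%:R * (d / 2) ->
    total_variation lo x u \is a fin_num.
  elim: n => [|n ih] x lox xhi; first rewrite mul0r subr_le0 => xlo.
    by rewrite (_ : x = lo) ?total_variationxx//; apply/eqP; rewrite eq_le xlo.
  rewrite -natr1 mulrDl mul1r => xn.
  pose x' := Num.max lo (x - d / 2).
  have x'x : x' <= x by rewrite ge_max lox/= gerBl divr_ge0// ltW.
  have lox' : lo <= x' by rewrite le_max lexx.
  rewrite (total_variationD u lox' x'x) fin_numD ih//=.
  - apply: small => //; rewrite ltrBlDl -ltrBlDr lt_max; apply/orP; right.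
    by rewrite ltrD2l ltrN2 ltr_pdivrMr// ltr_pMr// ltr1n.
  - exact: le_trans xhi.
  - rewrite lerBlDr ge_max lerDr mulr_ge0 ?divr_ge0 ?(ltW d0)//=.
    by move: xn; lra.
(* Steps of length d / 2 stay strictly below d. *)
apply: (main (Num.bound ((hi - lo) / (d / 2)))) => //.
rewrite -ler_pdivrMr ?divr_gt0//; apply/ltW/archi_boundP.
by rewrite !divr_ge0 ?subr_ge0// ltW.
Qed.

(** This makes u a difference of nondecreasing absolutely continuous functions:
its variation, and its variation minus u. *)
Lemma abs_continuous_on_TV lo hi u : abs_continuous_on lo hi u -> lo <= hi ->
  abs_continuous_on lo hi (fun x => fine (total_variation lo x u)).
Proof.
move=> acu lohi; apply/abs_continuous_onP => eps e0.
have e20 : 0 < eps / 2 by rewrite divr_gt0.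
have [d d0 ac] := (abs_continuous_onP _ _ _).1 acu _ e20.
exists d => // s sw sp sd.
have {}ac s' : all (within_itv lo hi) s' -> pairwise nonoverlap s' ->
      \sum_(p <- s') (p.2 - p.1) < d ->
      \sum_(p <- s') `|u p.2 - u p.1| <= eps / 2.
  by move=> s1 s2 s3; exact/ltW/ac.
have fin x : lo <= x -> x <= hi -> total_variation lo x u \is a fin_num.
  move=> lox xhi; have := abs_continuous_on_TV_fin acu lohi.
  by rewrite (total_variationD u lox xhi) fin_numD => /andP[].
have := sum_total_variation_le ac (s := s) (acc := [::]) sw sp sd.
rewrite big_nil add0r => H.
suff -> : \sum_(p <- s) `|fine (total_variation lo p.2 u) -
      fine (total_variation lo p.1 u)| =
    fine (\sum_(p <- s) total_variation p.1 p.2 u)%E.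
  apply: (@le_lt_trans _ _ (eps / 2)); last first.
    by rewrite ltr_pdivrMr// ltr_pMr// ltr1n.
  rewrite -lee_fin fineK// fin_numElt (le_lt_trans H) ?ltry// andbT.
  rewrite (@lt_le_trans _ _ 0%E)// big_seq; apply: sume_ge0.
  by move=> p /(allP sw)/within_itvP[_ ? _]; exact: total_variation_ge0.
rewrite big_seq [in RHS]big_seq -sum_fine.
  apply: eq_bigr => -[a b] /(allP sw)/within_itvP[/= la ab bh].
  have lb := le_trans la ab; have ah := le_trans ab bh.
  have := fin _ lb bh; rewrite (total_variationD u la ab) fin_numD => /andP[f1 f2].
  rewrite fineD// addrAC subrr add0r ger0_norm// fine_ge0//.
  exact: total_variation_ge0.
move=> [a b] /(allP sw)/within_itvP[/= la ab bh].
have := fin _ (le_trans la ab) bh.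
by rewrite (total_variationD u la ab) fin_numD => /andP[].
Qed.

End AbsCont.

(** * Stieltjes measures of absolutely continuous functions *)

Section Stieltjes.
Context {R : realType}.
Implicit Types (lo hi a b x y : R) (g : R -> R).

(** Composing with this map extends a function on [lo, hi] to the line, as
a function that is constant on both sides. *)
Definition clamp lo hi x : R := Num.max lo (Num.min x hi).

Lemma clamp_id lo hi x : lo <= x -> x <= hi -> clamp lo hi x = x.
Proof. by move=> lx xh; rewrite /clamp (min_idPl xh) (max_idPr lx). Qed.

Lemma clamp_ge lo hi x : lo <= clamp lo hi x.
Proof. by rewrite le_max lexx. Qed.

Lemma clamp_le lo hi x : lo <= hi -> clamp lo hi x <= hi.
Proof. by move=> lh; rewrite ge_max lh ge_min lexx orbT. Qed.

Lemma clamp_homo lo hi : {homo clamp lo hi : x y / x <= y}.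
Proof.
move=> x y xy; rewrite ge_max clamp_ge/= le_max; apply/orP; right.
by rewrite le_min ge_min xy/= ge_min lexx orbT.
Qed.

Lemma clamp_lip lo hi x y : lo <= hi -> x <= y ->
  clamp lo hi y - clamp lo hi x <= y - x.
Proof. by move=> lh xy; rewrite /clamp /Num.max /Num.min; do ?case: ifPn; lra. Qed.

Lemma abs_continuous_on_clamp lo hi g : lo <= hi -> abs_continuous_on lo hi g ->
  forall eps : R, 0 < eps -> exists2 delta : R, 0 < delta &
    forall s : seq (R * R), all (fun p => p.1 <= p.2) s -> pairwise nonoverlap s ->
      \sum_(p <- s) (p.2 - p.1) < delta ->
      \sum_(p <- s) `|g (clamp lo hi p.2) - g (clamp lo hi p.1)| < eps.
Proof.
move=> lh /abs_continuous_onP ac eps e0; have [d d0 dP] := ac _ e0.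
exists d => // s /allP s1 s2 sd.
have := dP [seq (clamp lo hi p.1, clamp lo hi p.2) | p <- s].
rewrite !big_map/=; apply.
- apply/allP => _ /mapP[p ps ->]; apply/within_itvP; split => /=.
  + exact: clamp_ge.
  + exact/clamp_homo/s1.
  + exact: clamp_le.
- rewrite pairwise_map; apply: sub_pairwise s2 => p q /orP[] pq; apply/orP.
  + by left; exact: clamp_homo.
  + by right; exact: clamp_homo.
- apply: le_lt_trans sd; rewrite big_seq [leRHS]big_seq; apply: ler_sum => p ps.
  exact/clamp_lip/s1.
Qed.

Lemma clamp_continuous lo hi g : lo <= hi -> abs_continuous_on lo hi g ->
  continuous (g \o clamp lo hi).
Proof.
move=> lh /(abs_continuous_on_clamp lh) ac x; apply/cvgrPdist_lt => e e0.
have [d d0 dP] := ac _ e0.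
have H a b : a <= b -> b - a < d ->
    `|g (clamp lo hi b) - g (clamp lo hi a)| < e.
  move=> ab abd; have := dP [:: (a, b)].
  by rewrite /= !big_seq1/= ab; exact.
near=> y; have : `|x - y| < d by near: y; exact: cvgr_dist_lt.
have [xy|/ltW yx] := leP x y.
  by rewrite distrC ger0_norm ?subr_ge0// distrC; exact: H.
by rewrite ger0_norm ?subr_ge0//; exact: H.
Unshelve. all: by end_near. Qed.

Lemma lebesgue_stieltjes_itvoc (f : cumulative R R) a b : a <= b ->
  lebesgue_stieltjes_measure f (`]a, b] : set R) = (f b - f a)%:E.
Proof.
move=> ab; rewrite /lebesgue_stieltjes_measure/= /measure_extension/=.
by rewrite measurable_mu_extE//; [exact: wlength_itv_bnd|exact: is_ocitv].
Qed.

(** Finite measure makes the endpoints finite, openness excludes them from the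
interval. *)
Lemma open_interval_finite (I : set R) : open I -> is_interval I ->
  (@lebesgue_measure R I < +oo)%E -> I !=set0 ->
  exists p : R * R, p.1 < p.2 /\ I = `]p.1, p.2[%classic.
Proof.
move=> oI /is_intervalP IE; rewrite IE; move: (Rhull I) IE => i IE.
rewrite lebesgue_measure_itv.
have Ii := (interior_id _).1 oI; rewrite IE in Ii.
case: i IE Ii => -[bl a|[]] [br b|[]] IE Ii/=; rewrite ?ltNye ?ltey ?lt_irr//=.
- rewrite -[X in X !=set0]Ii interior_itv => _ [x /=]; rewrite in_itv/= => xab.
  exists (a, b) => /=; case/andP: xab => ax xb; split; first exact: lt_trans xb.
  by rewrite -Ii interior_itv.
all: try by move=> _ [x]; rewrite /= in_itv ?andbF.
Qed.


Notation mu := (@lebesgue_measure R).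

(** A Lebesgue null set lies in an open set of small Lebesgue measure.  That set
is a countable disjoint union of open intervals, and the absolute continuity of
f bounds the sum of the increments of f over any finitely many of them. *)
Lemma stieltjes_dominated (f : cumulative R R) :
  (forall eps : R, 0 < eps -> exists2 delta : R, 0 < delta &
    forall s : seq (R * R), all (fun p => p.1 <= p.2) s -> pairwise nonoverlap s ->
      \sum_(p <- s) (p.2 - p.1) < delta ->
      \sum_(p <- s) `|f p.2 - f p.1| < eps) ->
  forall A : set (measurableTypeR R), measurable A -> mu A = 0 ->
    lebesgue_stieltjes_measure f A = 0.
Proof.
move=> ac A mA A0; apply/eqP; rewrite eq_le measure_ge0 andbT.
apply/lee_addgt0Pr => e e0; rewrite add0e.
have [d d0 dP] := ac _ e0.
have muA : (mu A < +oo)%E by rewrite A0 ltry.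
have [U [oU AU Ud]] := @lebesgue_regularity_outer R A d mA muA d0.
have mU : measurable (U : set (measurableTypeR R)) by exact: open_measurable.
have {}Ud : (mu U < d%:E)%E.
  apply: le_lt_trans Ud.
  have -> : mu U = mu (A `|` (U `\` A)) by rewrite setDUK.
  apply: (@le_trans _ _ (mu A + mu (U `\` A))%E).
    by apply: measureU2 => //; exact: measurableD.
  by rewrite A0 add0e.
apply: (@le_trans _ _ (lebesgue_stieltjes_measure f U)).
  by apply: le_measure => //; rewrite inE.
have [I [oiI tI UI]] := OpenSetDisjointItvs.open_disjoint_itv oU.
have mI n : measurable (I n : set (measurableTypeR R)) by apply: open_measurable; have [] := oiI n.
have lI n : (mu (I n) < +oo)%E.
  apply: (@le_lt_trans _ _ (mu U)); last by rewrite (lt_trans Ud) ?ltry.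
  have IU : I n `<=` U  by rewrite UI; exact: bigcup_sup.
  by apply: le_measure => //; rewrite inE.
have /choice[p pP] n : exists p : R * R, I n !=set0 ->
    p.1 < p.2 /\ I n = `]p.1, p.2[%classic.
  have [In0|] := pselect (I n !=set0); last by exists (0, 0).
  have [oI iI] := oiI n.
  by have [p ?] := open_interval_finite oI iI (lI n) In0; exists p.
rewrite UI measure_semi_bigcup//; last by rewrite -UI.
apply: lime_le; first by apply: is_cvg_nneseries.
apply: nearW => n.
(* For an empty interval the endpoints given by p are arbitrary. *)
pose s := [seq p k | k <- iota 0 n & `[<I k !=set0>]].
have sE (F : R * R -> R) : \sum_(q <- s) F q =
    \sum_(0 <= k < n | `[<I k !=set0>]) F (p k).
  by rewrite big_map big_filter /index_iota subn0.
have emptyI (m : {measure set (measurableTypeR R) -> \bar R}) :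
    (\sum_(0 <= k < n) m (I k) = \sum_(0 <= k < n | `[<I k !=set0>]) m (I k))%E.
  rewrite [RHS]big_mkcond; apply: eq_bigr => k _; case: ifPn => // /asboolPn.
  by move=> /nonemptyPn ->; rewrite measure0.
have s1 : all (fun p => p.1 <= p.2) s.
  apply/allP => _ /mapP[k + ->]; rewrite mem_filter => /andP[/asboolP + _].
  by move=> /pP[/ltW].
have s2 : pairwise nonoverlap s.
  rewrite pairwise_map.
  have : uniq [seq k <- iota 0 n | `[<I k !=set0>]].
    by rewrite filter_uniq ?iota_uniq.
  rewrite uniq_pairwise.
  apply: (@sub_in_pairwise _ (fun k => `[<I k !=set0>])); last first.
    by apply/allP => k; rewrite mem_filter => /andP[].
  move=> k l /asboolP/pP[pk Ik] /asboolP/pP[pl Il] /= kl.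
  apply/negPn/negP; rewrite negb_or -!ltNge => /andP[h1 h2].
  move/trivIsetP: tI => /(_ k l Logic.I Logic.I kl); apply/eqP/set0P.
  pose x := (Num.max (p k).1 (p l).1 + Num.min (p k).2 (p l).2) / 2.
  by exists x; rewrite Ik Il; split; rewrite /= in_itv/= /x /Num.max /Num.min;
    apply/andP; split; do ?case: ifPn; lra.
have s3 : \sum_(q <- s) (q.2 - q.1) < d.
  rewrite sE -lte_fin -sumEFin (le_lt_trans _ Ud)//.
  rewrite UI measure_semi_bigcup//; last by rewrite -UI.
  apply: le_trans (nneseries_lim_ge n _) => //.
  rewrite emptyI; apply: lee_sum => k /asboolP/pP[pk ->].
  have H : (((p k).2 - (p k).1)%:E <=
      lebesgue_measure (`](p k).1, (p k).2[%classic : set R))%E.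
    by rewrite lebesgue_measure_itv/= lte_fin pk.
  exact: H.
have := ltW (dP s s1 s2 s3); rewrite -lee_fin; apply: le_trans.
rewrite emptyI sE -sumEFin; apply: lee_sum => k /asboolP/pP[pk ->].
apply: (@le_trans _ _ (lebesgue_stieltjes_measure f (`](p k).1, (p k).2] : set R))).
  have oc : `](p k).1, (p k).2[ `<=` `](p k).1, (p k).2].
    exact: subset_itv_oo_oc.
  by apply: le_measure => //; rewrite inE; exact: measurable_itv.
rewrite lebesgue_stieltjes_itvoc ?(ltW pk)// lee_fin; exact: ler_norm.
Qed.


(** The density is the Radon-Nikodym derivative of the Stieltjes measure of the
clamped function, restricted to ]lo, hi] to make it finite. *)
Lemma nondecreasing_abs_continuous_density lo hi g : lo <= hi ->
  (forall x y, lo <= x -> x <= y -> y <= hi -> g x <= g y) ->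
  abs_continuous_on lo hi g ->
  exists2 h : R -> R, mu.-integrable setT (EFin \o h) &
    forall x, lo <= x -> x <= hi -> g x - g lo = \int[mu]_(t in `[lo, x]) h t.
Proof.
move=> lh ndg acg; pose G := g \o clamp lo hi.
have Gnd : {homo G : x y / x <= y}.
  move=> x y xy; apply: ndg; [exact: clamp_ge|exact: clamp_homo|exact: clamp_le].
have Grc : right_continuous G.
  by apply: right_continuousW; exact: clamp_continuous.
pose F : cumulative R R := HB.pack G (isCumulative.Build R _ R G Gnd Grc).
pose nu := lebesgue_stieltjes_measure F.
have mI : measurable (`]lo, hi]%classic : set (measurableTypeR R)).
  exact: measurable_itv.
have nuE x y : x <= y -> nu (`]x, y] : set R) = (G y - G x)%:E.
  exact: lebesgue_stieltjes_itvoc.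
have nuI : (nu (`]lo, hi] : set R) < +oo)%E by rewrite nuE ?ltry.
pose nu' := charge_of_finite_measure (mfrestr mI nuI).
have dom : nu' `<< mu.
  apply/null_content_dominatesP => A mA A0.
  rewrite /nu' /charge_of_finite_measure/= /mfrestr/= /mrestr/=.
  apply: (@stieltjes_dominated F (abs_continuous_on_clamp lh acg)).
    exact: measurableI.
  apply/eqP; rewrite eq_le measure_ge0 andbT -A0.
  by apply: le_measure; rewrite ?inE//; exact: measurableI.
have intf := Radon_Nikodym_integrable dom.
have finf (x : measurableTypeR R) := Radon_Nikodym_fin_num x dom.
have mf A (mA : measurable A) := Radon_Nikodym_integral dom mA.
move: intf finf mf; set f := Radon_Nikodym _ _ => intf finf mf.
exists (fine \o f).
  by rewrite (_ : EFin \o _ = f)//; apply/funext => x /=; rewrite fineK.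
move=> x lx xh.
have mx : measurable (`]lo, x]%classic : set (measurableTypeR R)).
  exact: measurable_itv.
rewrite -Rintegral_itv_obnd_cbnd; last first.
  apply: (@integrableS _ _ _ mu setT) => //.
  by rewrite (_ : EFin \o _ = f)//; apply/funext => t /=; rewrite fineK.
rewrite /Rintegral.
rewrite (eq_integral f); last by move=> t _ /=; rewrite fineK.
rewrite -(mf _ mx).
rewrite /nu' /charge_of_finite_measure/= /mfrestr/= /mrestr/= setIidl.
  by rewrite -/nu nuE//= /G/= !clamp_id.
by apply: subset_itvl; rewrite bnd_simp.
Qed.

End Stieltjes.

(** * Densities on compact intervals *)

Section Density.
Context {R : realType}.
Implicit Types (lo hi a b x y : R) (g u h : R -> R).
Notation mu := (@lebesgue_measure R).

(** The monotone case applies to the variation V of u and to V - u. *)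
Lemma abs_continuous_on_density lo hi u : lo <= hi -> abs_continuous_on lo hi u ->
  exists2 h : R -> R, mu.-integrable setT (EFin \o h) &
    forall x, lo <= x -> x <= hi -> u x - u lo = \int[mu]_(t in `[lo, x]) h t.
Proof.
move=> lh acu; pose V x := fine (total_variation lo x u).
have acV : abs_continuous_on lo hi V by exact: abs_continuous_on_TV.
have Vfin := abs_continuous_on_TV_fin acu lh.
have VD x y : lo <= x -> x <= y -> y <= hi -> `|u y - u x| <= V y - V x.
  move=> lx xy yh; have ly := le_trans lx xy.
  move: Vfin; rewrite (total_variationD u ly yh) fin_numD => /andP[+ _].
  rewrite /V (total_variationD u lx xy) fin_numD => /andP[f1 f2].
  rewrite fineD// addrAC subrr add0r -lee_fin fineK//.
  exact: total_variation_ge.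
have acW : abs_continuous_on lo hi (fun x => V x - u x).
  have := abs_continuous_onDZ 1 (-1) acV acu.
  by congr (abs_continuous_on _ _ _); apply/funext => x; rewrite mul1r mulN1r.
have [|h1 ih1 h1P] := @nondecreasing_abs_continuous_density R lo hi V lh _ acV.
  by move=> x y lx xy yh; rewrite -subr_ge0 (le_trans _ (VD _ _ lx xy yh)).
have [|h2 ih2 h2P] :=
    @nondecreasing_abs_continuous_density R lo hi (fun x => V x - u x) lh _ acW.
  move=> x y lx xy yh; rewrite -subr_ge0.
  have := VD _ _ lx xy yh; have := ler_norm (u y - u x); lra.
exists (fun x => h1 x - h2 x) => [|x lx xh].
  rewrite (_ : _ \o _ = (EFin \o h1) \- (EFin \o h2))%E//.
  exact: integrableB.
rewrite RintegralB//; [|exact: integrableS ih1|exact: integrableS ih2].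
rewrite -h1P// -h2P//; ring.
Qed.

(** The indefinite integral of h has the derivative h at its Lebesgue points. *)
Lemma abs_continuous_on_derivative lo hi u : lo <= hi -> abs_continuous_on lo hi u ->
  exists h : R -> R, [/\ mu.-integrable setT (EFin \o h),
    forall x y, lo <= x -> x <= y -> y <= hi ->
      u y - u x = \int[mu]_(t in `[x, y]) h t &
    {ae mu, forall x, lo < x -> x < hi -> is_derive x 1 u (h x)}].
Proof.
move=> lh /(abs_continuous_on_density lh)[h ih hP]; exists h; split => //.
  move=> x y lx xy yh.
  have -> : u y - u x = (u y - u lo) - (u x - u lo) by ring.
  rewrite !hP ?(le_trans lx xy) ?(le_trans xy yh)//.
  rewrite Rintegral_itvB//.
  - by rewrite Rintegral_itv_obnd_cbnd//; exact: integrableS ih.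
  - exact: integrableS ih.
have := lebesgue_differentiation (open_integrable_locally openT ih).
apply: filterS; first exact: (ae_filter_ringOfSetsType mu).
move=> x hx lx xh.
have ihh : mu.-integrable `[lo, hi] (EFin \o h) by exact: integrableS ih.
have lx' : (BLeft lo < BRight x)%E by rewrite lte_fin.
have [dF Fx] := FTC1_lebesgue_pt xh ihh lx' hx.
set F := (fun y => _) in dF Fx.
have : is_derive x 1 (fun y => F y + cst (u lo) y) (h x).
  rewrite -[h x]addr0 -Fx derive1E; apply: is_deriveD.
  exact: derivableP.
apply: near_eq_is_derive; near=> y; rewrite /F -hP ?subrK//.
- by near: y; apply: filterS (lt_nbhsr lx) => z /ltW.
- by near: y; apply: filterS (lt_nbhsl xh) => z /ltW.
Unshelve. all: by end_near. Qed.


End Density.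

(** * Integrals of almost everywhere equal functions *)

Section AlmostEverywhere.
Import HBNNSimple.
Context d (T : measurableType d) (R : realType) (mu : {measure set T -> \bar R}).
Implicit Types f g : T -> \bar R.

Let nnintegral f := ereal_sup [set sintegral mu h |
  h in [set h : {nnsfun T >-> R} | forall x, ((h x)%:E <= f x)%E]].

(** A simple function below f stays below g and keeps its integral when it is
set to 0 on a null set. *)
Let nnintegral_ae_le f g : (forall x, 0 <= g x)%E ->
  {ae mu, forall x, (f x <= g x)%E} -> (nnintegral f <= nnintegral g)%E.
Proof.
move=> g0 [N [mN N0 fgN]]; apply: ge_ereal_sup => _ [h hf <-].
apply: ereal_sup_ubound.
have mNC : measurable (~` N) by exact: measurableC.
exists (proj_nnsfun h mNC).
  move=> x /=; rewrite /proj_nnsfun/= mindicE; case: (boolP (x \in ~` N)) => xN.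
    rewrite mulr1 (le_trans (hf x))//; apply: contrapT => nfg.
    by move: xN; rewrite inE; apply; exact: fgN.
  by rewrite mulr0.
rewrite -!integralT_nnsfun; apply: ae_eq_integral => //.
- exact/measurable_EFinP.
- exact/measurable_EFinP.
- exists N; split => // x /= /not_implyP[_]; apply: contra_notP => xN.
  by rewrite /proj_nnsfun/= mindicE mem_set// mulr1.
Qed.

(** This holds for arbitrary functions, and is needed for classical derivatives:
their values are arbitrary where the derivative does not exist. *)
Lemma eq_integral_ae (D : set T) f g :
  {ae mu, forall x, D x -> f x = g x} ->
  (\int[mu]_(x in D) f x = \int[mu]_(x in D) g x)%E.
Proof.
move=> fg; have {}fg : {ae mu, forall x, (f \_ D) x = (g \_ D) x}.
  apply: filterS fg => x fg; rewrite !patchE; case: ifPn => //.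
  by rewrite inE => /fg.
rewrite /integral; congr (_ - _)%E; apply/eqP; rewrite eq_le; apply/andP; split;
  apply: nnintegral_ae_le; do ?by move=> x; rewrite ?funepos_ge0 ?funeneg_ge0.
- by apply: filterS fg => x fg; rewrite !funeposE fg.
- by apply: filterS fg => x fg; rewrite !funeposE fg.
- by apply: filterS fg => x fg; rewrite !funenegE fg.
- by apply: filterS fg => x fg; rewrite !funenegE fg.
Qed.

Lemma ae_integrable (D : set T) f g : measurable D ->
  measurable_fun D g -> mu.-integrable D f ->
  {ae mu, forall x, D x -> f x = g x} -> mu.-integrable D g.
Proof.
move=> mD mg /integrableP[mf intf] fg; apply/integrableP; split => //.
apply: le_lt_trans intf; rewrite le_eqVlt; apply/orP; left; apply/eqP.
by apply: eq_integral_ae; apply: filterS fg => x fg Dx; rewrite fg.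
Qed.

End AlmostEverywhere.

(** * Borel derivatives on the half-line *)

Section LocalDensity.
Context {R : realType}.
Implicit Types (lo hi a b x y : R) (g u h : R -> R).
Notation mu := (@lebesgue_measure R).

(** A Borel version of the derivative, with which integrals of derivatives can be
computed. *)
Definition is_density u h : Prop :=
  [/\ measurable_fun (@halfline R) h,
      {ae mu, forall x, 0 < x -> is_derive x 1 u (h x)} &
      forall x y, 0 < x -> x <= y ->
        mu.-integrable `[x, y] (EFin \o h) /\
        u y - u x = \int[mu]_(t in `[x, y]) h t].

Lemma halflineE x : @halfline R x = (0 < x) :> Prop.
Proof. by rewrite /halfline/= in_itv/= andbT. Qed.

Lemma loc_abs_continuous_continuous u : loc_abs_continuous u ->
  {in @halfline R, continuous u}.
Proof.
move=> acu x; rewrite inE halflineE => x0.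
have lh : x / 2 <= x + 1 by lra.
have l0 : 0 < x / 2 by rewrite divr_gt0.
have E : \forall z \near x, u (clamp (x / 2) (x + 1) z) = u z.
  near=> z; rewrite /= clamp_id//.
    by near: z; apply: lt_le_nbhsr; lra.
  by near: z; apply: lt_le_nbhsl; lra.
have : (u \o clamp (x / 2) (x + 1)) z @[z --> x] --> u x.
  rewrite -(nbhs_singleton E).
  exact: (@clamp_continuous R _ _ _ lh (acu _ _ l0 lh) x).
apply: cvg_trans; apply: near_eq_cvg; exact: E.
Unshelve. all: by end_near. Qed.

Lemma is_derive_cvg_quotient u (x l : R) : is_derive x 1 u l ->
  (fun n => n.+1%:R * (u (x + n.+1%:R^-1) - u x)) @ \oo --> l.
Proof.
move=> [du <-].
have /cvgr_dnbhsP/(_ (fun n => n.+1%:R^-1)) := du.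
rewrite /derive => H.
have n0 n : n.+1%:R^-1 != 0 :> R by rewrite invr_eq0 pnatr_eq0.
have := H (conj n0 (@cvg_harmonic R)).
under eq_fun do rewrite /= invrK/= [_%:A]mulr1 [_ + x]addrC.
exact.
Qed.

(** The upper limit of the difference quotients over [x, x + 1/(n+1)] is Borel and
equals the derivative where this exists, hence almost everywhere; so it agrees
almost everywhere with the density on each compact interval. *)
Lemma loc_abs_continuous_density u : loc_abs_continuous u ->
  exists h, is_density u h.
Proof.
move=> acu.
pose D n x : R := n.+1%:R * (u (x + n.+1%:R^-1) - u x).
have cu := loc_abs_continuous_continuous acu.
have oI : open (@halfline R) by exact: interval_open.
have mI : measurable (@halfline R) by exact: measurable_itv.
have mD n : measurable_fun (@halfline R) (EFin \o D n).
  apply/measurable_EFinP; apply: (@open_continuous_measurable_fun R _ _ oI) => x xI.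
  have [x0 xn0] : 0 < x /\ 0 < x + n.+1%:R^-1.
    by move: xI; rewrite inE halflineE => x0; rewrite addr_gt0.
  apply: cvgM; first exact: cvg_cst.
  apply: cvgB; last exact: cu.
  apply: (@continuous_comp _ _ _ (fun x => x + n.+1%:R^-1) u).
    by apply: cvgD; [exact: cvg_id|exact: cvg_cst].
  by apply: cu; rewrite inE halflineE.
pose h x := fine (limn_esup (fun n => (D n x)%:E)).
have hE x l : is_derive x 1 u l -> h x = l.
  move=> /is_derive_cvg_quotient ul; rewrite /h.
  have /cvg_limn_einf_sup[_ ->//] : (fun n => (D n x)%:E) @ \oo --> l%:E.
  by apply: cvg_EFin; [exact: nearW|exact: ul].
have pos n : 0 < n.+1%:R^-1 :> R by rewrite invr_gt0.
have ninv n : n.+1%:R^-1 <= n.+1%:R :> R.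
  by rewrite (@le_trans _ _ 1)// ?invf_le1 ?ler1n.
have dh : {ae mu, forall x, 0 < x -> is_derive x 1 u (h x)}.
  have : {ae mu, forall x, forall n, n.+1%:R^-1 < x -> x < n.+1%:R ->
      is_derive x 1 u (h x)}.
    apply/ae_foralln => n.
    have [h' [_ _]] := abs_continuous_on_derivative (ninv n) (acu _ _ (pos n) (ninv n)).
    apply: filterS; first exact: (ae_filter_ringOfSetsType mu).
    by move=> x dx nx xn; have dux := dx nx xn; rewrite (hE _ _ dux).
  apply: filterS; first exact: (ae_filter_ringOfSetsType mu).
  move=> x xP x0.
  pose n := maxn (Num.bound x) (Num.bound x^-1).
  have bnd y : 0 < y -> (Num.bound y <= n)%N -> y < n.+1%:R.
    move=> y0 yn; rewrite (lt_le_trans (archi_boundP (ltW y0)))// ler_nat.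
    exact: leqW.
  apply: (xP n); last by apply: bnd => //; rewrite leq_maxl.
  by rewrite -[ltRHS]invrK ltf_pV2 ?posrE ?invr_gt0// bnd ?invr_gt0 ?leq_maxr.
have mh : measurable_fun (@halfline R) h.
  apply: measurableT_comp; first exact: fine_measurable.
  exact: measurable_fun_limn_esup.
exists h; split => // x y x0 xy.
have [h' [ih' hP' dh']] := abs_continuous_on_derivative xy (acu _ _ x0 xy).
have hh' : {ae mu, forall z, `[x, y] z -> (EFin \o h') z = (EFin \o h) z}.
  have [N [mN N0 xN]] := dh'.
  exists (N `|` ([set x] `|` [set y])); split.
  - apply: measurableU => //; exact: measurableU.
  - have xy0 : mu ([set x] `|` [set y]) = 0.
      by rewrite measureU0//; [exact: lebesgue_measure_set1|
        exact: lebesgue_measure_set1].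
    by rewrite measureU0//; exact: measurableU.
  - move=> z /=; apply: contra_notP => /not_orP[zN /not_orP[zx zy]].
    rewrite in_itv/= => /andP[xz zy']; congr EFin; apply/esym/hE.
    apply: contrapT => nd; apply/zN/xN => /= H; apply/nd/H.
      by rewrite lt_neqAle xz andbT; apply/eqP => /esym.
    by rewrite lt_neqAle zy' andbT; exact/eqP.
have mhxy : measurable_fun `[x, y] (EFin \o h).
  apply/measurable_EFinP; apply: measurable_funS mh => // z /=.
  by rewrite in_itv/= halflineE => /andP[/(lt_le_trans x0)].
split.
  apply: ae_integrable hh' => //; exact: integrableS ih'.
by rewrite hP'// /Rintegral (eq_integral_ae hh').
Qed.

End LocalDensity.

(** * The Bessel form *)

Section Forms.
Context {R : realType}.
Implicit Types (lo hi a b x y c d : R) (f g u v w h k : R -> R).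
Notation mu := (@lebesgue_measure R).
Notation I := (@halfline R).

Lemma measurable_halfline : measurable (I : set (measurableTypeR R)).
Proof. exact: measurable_itv. Qed.
Hint Resolve measurable_halfline : core.

#[local] Instance ae_lebesgue_filter_R : Filter (almost_everywhere mu) :=
  ae_filter_ringOfSetsType mu.

Lemma abs_continuous_on_bounded lo hi u : abs_continuous_on lo hi u -> lo <= hi ->
  exists2 M, 0 <= M & forall x, lo <= x -> x <= hi -> `|u x| <= M.
Proof.
move=> acu lh; have fin := abs_continuous_on_TV_fin acu lh.
exists (`|u lo| + fine (total_variation lo hi u)).
  by rewrite addr_ge0// fine_ge0// total_variation_ge0.
move=> x lx xh; rewrite -[u x](subrK (u lo)) addrC (le_trans (ler_normD _ _))//.
rewrite lerD2l -lee_fin fineK// (total_variationD u lx xh).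
rewrite (le_trans (total_variation_ge u lx))// leeDl//.
exact: total_variation_ge0.
Qed.

Lemma abs_continuous_onM lo hi u w : lo <= hi ->
  abs_continuous_on lo hi u -> abs_continuous_on lo hi w ->
  abs_continuous_on lo hi (fun x => u x * w x).
Proof.
move=> lh acu acw.
have [M M0 uM] := abs_continuous_on_bounded acu lh.
have [N N0 wN] := abs_continuous_on_bounded acw lh.
move=> eps e0; pose K := M + N + 1; have K0 : 0 < K by rewrite ltr_wpDl ?addr_ge0.
have e0' : 0 < eps / K / 2 by rewrite !divr_gt0.
have [d1 d10 d1P] := acu _ e0'; have [d2 d20 d2P] := acw _ e0'.
exists (Num.min d1 d2); first by rewrite lt_min d10.
move=> n x y xy dis; rewrite lt_min => /andP[s1 s2].
have h1 := d1P n x y xy dis s1; have h2 := d2P n x y xy dis s2.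
have -> : eps = K * (eps / K / 2 + eps / K / 2).
  by field; rewrite gt_eqF.
apply: le_lt_trans (_ : _ <= K * (\sum_(i < n) `|u (y i) - u (x i)| +
  \sum_(i < n) `|w (y i) - w (x i)|)) _; last first.
  by rewrite ltr_pM2l// ltrD.
rewrite -big_split/= mulr_sumr; apply: ler_sum => i _.
have [lx [xy' yh]] := xy i.
have -> : u (y i) * w (y i) - u (x i) * w (x i) =
  (u (y i) - u (x i)) * w (y i) + u (x i) * (w (y i) - w (x i)) by ring.
rewrite (le_trans (ler_normD _ _))// !normrM mulrDr lerD//.
  rewrite mulrC ler_wpM2r// (le_trans (wN _ (le_trans lx xy') yh))//.
  by rewrite /K; lra.
rewrite ler_wpM2r// (le_trans (uM _ lx (le_trans xy' yh)))//.
by rewrite /K; lra.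
Qed.

(** Because |f g| <= f^2 + g^2. *)
Lemma integrable_mul_sq (D : set R) f g w : measurable D ->
  measurable_fun D f -> measurable_fun D g -> measurable_fun D w ->
  (forall x, D x -> 0 <= w x) ->
  mu.-integrable D (EFin \o (fun x => f x ^+ 2 * w x)) ->
  mu.-integrable D (EFin \o (fun x => g x ^+ 2 * w x)) ->
  mu.-integrable D (EFin \o (fun x => f x * g x * w x)).
Proof.
move=> mD mf mg mw w0 intf intg.
apply: (@le_integrable _ _ _ mu D mD _
  (EFin \o (fun x => f x ^+ 2 * w x + g x ^+ 2 * w x))).
- apply/measurable_EFinP; apply: measurable_funM => //; exact: measurable_funM.
- move=> x Dx /=; rewrite lee_fin normrM (ger0_norm (w0 _ Dx)).
  rewrite [leRHS]ger0_norm; last by rewrite addr_ge0// mulr_ge0 ?sqr_ge0 ?w0.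
  rewrite -mulrDl ler_wpM2r ?w0// ler_norml; apply/andP.
  by split; nra.
- exact: (integrableD _ intf intg).
Qed.

Lemma is_density_derive1 u h : is_density u h ->
  {ae mu, forall x, I x -> derive1 u x = h x}.
Proof.
move=> [_ dh _]; apply: filterS dh => x dh; rewrite halflineE => /dh du.
by rewrite derive1E; exact: derive_val.
Qed.

Lemma bessel_form_density u w h k : is_density u h -> is_density w k ->
  bessel_form u w = \int[mu]_(x in I) (h x * k x * x ^+ 2).
Proof.
move=> /is_density_derive1 uh /is_density_derive1 wk.
rewrite /bessel_form /Rintegral; congr fine; apply: eq_integral_ae.
by apply: filterS2 uh wk => x uh wk Ix; rewrite uh// wk.
Qed.

Lemma is_density_lin c d u w h k : is_density u h -> is_density w k ->
  is_density (fun x => c * u x + d * w x) (fun x => c * h x + d * k x).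
Proof.
move=> [mh dh hP] [mk dk kP]; split.
- by apply: measurable_funD; apply: measurable_funM.
- apply: filterS2 dh dk => x dh dk x0; have du := dh x0; have dw := dk x0.
  have -> : c * h x + d * k x = c *: h x + d *: k x by [].
  exact: is_deriveD.
- move=> x y x0 xy; have [ih uE] := hP x y x0 xy; have [ik wE] := kP x y x0 xy.
  have i1 : mu.-integrable `[x, y] (EFin \o (fun t => c * h t)).
    exact: (integrableZl _ c ih).
  have i2 : mu.-integrable `[x, y] (EFin \o (fun t => d * k t)).
    exact: (integrableZl _ d ik).
  split; first exact: (integrableD _ i1 i2).
  rewrite RintegralD// !RintegralZl// -uE -wE; ring.
Qed.

Lemma bessel_dom_density u : bessel_dom u -> exists h, is_density u h.
Proof. by move=> [acu _ _]; exact: loc_abs_continuous_density. Qed.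

Lemma bessel_dom_measurable u : bessel_dom u -> measurable_fun I u.
Proof.
move=> [acu _ _]; have oI : open I by exact: interval_open.
exact: (open_continuous_measurable_fun oI (loc_abs_continuous_continuous acu)).
Qed.

Lemma measurable_sqr (D : set R) (c : R) :
  measurable_fun D (fun x : R => c * x ^+ 2).
Proof.
by apply: measurable_funM => //; apply: measurable_funX.
Qed.

Lemma measurable_sqr1 (D : set R) : measurable_fun D (fun x : R => x ^+ 2).
Proof. exact: measurable_funX. Qed.

Lemma ge0_integrableP (D : set R) f : measurable D -> measurable_fun D f ->
  (forall x, D x -> 0 <= f x) -> (\int[mu]_(x in D) (f x)%:E < +oo)%E ->
  mu.-integrable D (EFin \o f).
Proof.
move=> mD mf f0 intf; apply/integrableP; split; first exact/measurable_EFinP.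
apply: le_lt_trans intf; rewrite le_eqVlt; apply/orP; left; apply/eqP.
by apply: eq_integral => x /set_mem Dx /=; rewrite ger0_norm// f0.
Qed.

Lemma bessel_dom_integrable_inner u : bessel_dom u ->
  mu.-integrable I (EFin \o (fun x => u x ^+ 2 * (2 * x ^+ 2))).
Proof.
move=> /[dup] /bessel_dom_measurable mu_ [_ intu _]; apply: ge0_integrableP => //.
- apply: measurable_funM; first exact: measurable_funX.
  exact: measurable_sqr.
- by move=> x _; rewrite mulr_ge0 ?sqr_ge0// mulr_ge0 ?sqr_ge0.
Qed.

Lemma bessel_dom_integrable_form u h : bessel_dom u -> is_density u h ->
  mu.-integrable I (EFin \o (fun x => h x ^+ 2 * x ^+ 2)).
Proof.
move=> [_ _ intu] /[dup] /is_density_derive1 uh [mh _ _].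
apply: ge0_integrableP => //.
- apply: measurable_funM; first exact: measurable_funX.
  exact: measurable_sqr1.
- by move=> x _; rewrite mulr_ge0 ?sqr_ge0.
- apply: le_lt_trans intu; rewrite le_eqVlt; apply/orP; left; apply/eqP.
  by apply: eq_integral_ae; apply: filterS uh => x uh Ix; rewrite uh.
Qed.

Lemma integrable_form2 u w h k : bessel_dom u -> bessel_dom w ->
  is_density u h -> is_density w k ->
  mu.-integrable I (EFin \o (fun x => h x * k x * x ^+ 2)).
Proof.
move=> du dw uh wk; have [mh _ _] := uh; have [mk _ _] := wk.
apply: (integrable_mul_sq measurable_halfline mh mk (@measurable_sqr1 _)).
- by move=> x _; exact: sqr_ge0.
- exact: (bessel_dom_integrable_form du uh).
- exact: (bessel_dom_integrable_form dw wk).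
Qed.

Lemma integrable_inner2 u w : bessel_dom u -> bessel_dom w ->
  mu.-integrable I (EFin \o (fun x => u x * w x * (2 * x ^+ 2))).
Proof.
move=> du dw; apply: (integrable_mul_sq measurable_halfline
  (bessel_dom_measurable du) (bessel_dom_measurable dw) (@measurable_sqr _ 2)).
- by move=> x _; rewrite mulr_ge0// sqr_ge0.
- exact: (bessel_dom_integrable_inner du).
- exact: (bessel_dom_integrable_inner dw).
Qed.

Lemma loc_abs_continuous_lin c d u w : loc_abs_continuous u ->
  loc_abs_continuous w -> loc_abs_continuous (fun x => c * u x + d * w x).
Proof. by move=> au aw lo hi l0 lh; apply: abs_continuous_onDZ; auto. Qed.

Lemma integrable_sq_lin (D : set R) c d f g w : measurable D ->
  measurable_fun D f -> measurable_fun D g -> measurable_fun D w ->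
  (forall x, D x -> 0 <= w x) ->
  mu.-integrable D (EFin \o (fun x => f x ^+ 2 * w x)) ->
  mu.-integrable D (EFin \o (fun x => g x ^+ 2 * w x)) ->
  mu.-integrable D (EFin \o (fun x => (c * f x + d * g x) ^+ 2 * w x)).
Proof.
move=> mD mf mg mw w0 intf intg; have intfg := integrable_mul_sq mD mf mg mw w0 intf intg.
have mD' : measurable (D : set (measurableTypeR R)) by [].
have H := integrableD mD' (integrableZl mD' (c ^+ 2) intf)
  (integrableD mD' (integrableZl mD' (2 * c * d) intfg)
  (integrableZl mD' (d ^+ 2) intg)).
apply: eq_integrable H => // x _ /=.
by rewrite -!EFinM -!EFinD; congr EFin; ring.
Qed.

Lemma bessel_dom_lin c d u w : bessel_dom u -> bessel_dom w ->
  bessel_dom (fun x => c * u x + d * w x).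
Proof.
move=> du dw; have [h uh] := bessel_dom_density du.
have [k wk] := bessel_dom_density dw.
have [mh _ _] := uh; have [mk _ _] := wk.
split.
- by apply: loc_abs_continuous_lin; [case: du|case: dw].
- have := integrable_sq_lin c d measurable_halfline (bessel_dom_measurable du)
    (bessel_dom_measurable dw) (@measurable_sqr _ 2) _
    (bessel_dom_integrable_inner du) (bessel_dom_integrable_inner dw).
  move=> /(_ (fun x _ => mulr_ge0 (ler0n _ 2) (sqr_ge0 x)))/integrableP[_].
  apply: le_lt_trans; rewrite le_eqVlt; apply/orP; left; apply/eqP.
  by apply: eq_integral => x _ /=; rewrite ger0_norm// mulr_ge0 ?sqr_ge0// mulr_ge0 ?sqr_ge0.
- have := integrable_sq_lin c d measurable_halfline mh mk (@measurable_sqr1 _) _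
    (bessel_dom_integrable_form du uh) (bessel_dom_integrable_form dw wk).
  move=> /(_ (fun x _ => sqr_ge0 x))/integrableP[_].
  apply: le_lt_trans; rewrite le_eqVlt; apply/orP; left; apply/eqP.
  apply: eq_integral_ae.
  apply: filterS (is_density_derive1 (is_density_lin c d uh wk)) => x E Ix /=.
  by rewrite E// ger0_norm// mulr_ge0 ?sqr_ge0.
Qed.

Lemma bessel_form_shiftC lam u w :
  bessel_form_shift lam u w = bessel_form_shift lam w u.
Proof.
rewrite /bessel_form_shift.
have -> : bessel_form u w = bessel_form w u.
  by apply: eq_Rintegral => x _; rewrite [derive1 u x * _]mulrC.
have -> // : bessel_inner u w = bessel_inner w u.
by apply: eq_Rintegral => x _; rewrite [u x * _]mulrC.
Qed.

Lemma bessel_form_shift_linl lam c d u v w :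
  bessel_dom u -> bessel_dom v -> bessel_dom w ->
  bessel_form_shift lam (fun x => c * u x + d * v x) w =
  c * bessel_form_shift lam u w + d * bessel_form_shift lam v w.
Proof.
move=> du dv dw; have [h uh] := bessel_dom_density du.
have [k vk] := bessel_dom_density dv; have [l wl] := bessel_dom_density dw.
rewrite /bessel_form_shift (bessel_form_density (is_density_lin c d uh vk) wl).
rewrite (bessel_form_density uh wl) (bessel_form_density vk wl).
have i1 := integrable_form2 du dw uh wl; have i2 := integrable_form2 dv dw vk wl.
have -> : \int[mu]_(x in I) ((c * h x + d * k x) * l x * x ^+ 2) =
    c * \int[mu]_(x in I) (h x * l x * x ^+ 2) +
    d * \int[mu]_(x in I) (k x * l x * x ^+ 2).
  rewrite -!RintegralZl// -RintegralD//.
  - by apply: eq_Rintegral => x _; ring.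
  - exact: (integrableZl _ c i1).
  - exact: (integrableZl _ d i2).
have j1 := integrable_inner2 du dw; have j2 := integrable_inner2 dv dw.
have -> : bessel_inner (fun x => c * u x + d * v x) w =
    c * bessel_inner u w + d * bessel_inner v w.
  rewrite /bessel_inner -!RintegralZl// -RintegralD//.
  - by apply: eq_Rintegral => x _; ring.
  - exact: (integrableZl _ c j1).
  - exact: (integrableZl _ d j2).
ring.
Qed.

Lemma bessel_form_ge0 u : 0 <= bessel_form u u.
Proof. by apply: Rintegral_ge0 => x _; rewrite -expr2 mulr_ge0 ?sqr_ge0. Qed.

Lemma bessel_form_le_shift lam u : 0 <= lam ->
  bessel_form u u <= bessel_form_shift lam u u.
Proof.
move=> l0; rewrite /bessel_form_shift lerDl mulr_ge0//.
by apply: Rintegral_ge0 => x _; rewrite -expr2 mulr_ge0 ?sqr_ge0// mulr_ge0 ?sqr_ge0.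
Qed.

End Forms.

Local Hint Resolve measurable_halfline : core.

#[local] Instance ae_lebesgue_filter (R : realType) :
  Filter (almost_everywhere (@lebesgue_measure R)) := ae_filter_ringOfSetsType _.

(** * Pointwise bounds by the energy *)

Section Embedding.
Context {R : realType}.
Implicit Types (lo hi a b x y c d : R) (f g u v w h k : R -> R).
Notation mu := (@lebesgue_measure R).
Notation I := (@halfline R).
Lemma loc_lipschitz_abs_continuous u :
  (forall lo hi, 0 < lo -> lo <= hi -> exists K, forall x y, lo <= x -> x <= y ->
     y <= hi -> `|u y - u x| <= K * (y - x)) -> loc_abs_continuous u.
Proof.
move=> uK lo hi l0 lh; have [K KP] := uK _ _ l0 lh.
exact: lipschitz_abs_continuous_on KP.
Qed.

Lemma loc_abs_continuous_inv : loc_abs_continuous (fun x : R => x^-1).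
Proof.
apply: loc_lipschitz_abs_continuous => lo hi l0 lh.
exists (lo^-1 ^+ 2) => x y lx xy yh.
have x0 := lt_le_trans l0 lx; have y0 := lt_le_trans x0 xy.
have -> : y^-1 - x^-1 = - ((x^-1 * y^-1) * (y - x)).
  by field; rewrite !gt_eqF.
rewrite normrN normrM (ger0_norm (_ : 0 <= y - x)) ?subr_ge0//.
rewrite ler_wpM2r ?subr_ge0// ger0_norm ?mulr_ge0 ?invr_ge0 ?(ltW x0) ?(ltW y0)//.
by rewrite expr2 ler_pM ?invr_ge0 ?(ltW x0) ?(ltW y0)// lef_pV2// ?posrE// (le_trans lx).
Qed.

Lemma itv_sub_halfline x y : 0 < x -> `[x, y] `<=` I.
Proof. by move=> x0 t; rewrite halflineE /= in_itv/= => /andP[/(lt_le_trans x0)]. Qed.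

(** The density of f is almost everywhere equal to its derivative g. *)
Lemma is_density_FTC f g x y : loc_abs_continuous f -> measurable_fun I g ->
  (forall t : R, 0 < t -> is_derive t 1 f (g t)) -> 0 < x -> x <= y ->
  mu.-integrable `[x, y] (EFin \o g) /\ \int[mu]_(t in `[x, y]) g t = f y - f x.
Proof.
move=> /loc_abs_continuous_density[h fh] mg fg x0 xy.
have [mh dh hP] := fh; have [ih ->] := hP _ _ x0 xy.
have hg : {ae mu, forall t, `[x, y] t -> (EFin \o h) t = (EFin \o g) t}.
  apply: filterS (is_density_derive1 fh) => t dt /(itv_sub_halfline x0) It.
  rewrite /= -dt// derive1E; congr EFin; move: It; rewrite halflineE => /fg dft.
  exact: derive_val.
split; last by rewrite /Rintegral (eq_integral_ae hg).
apply: ae_integrable hg => //; apply/measurable_EFinP.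
apply: measurable_funS mg; first exact: measurable_halfline.
exact: (@itv_sub_halfline _ _ x0).
Qed.

Lemma le_Rintegral_subset (A B : set R) f : measurable A -> measurable B ->
  A `<=` B -> (forall x, B x -> 0 <= f x) -> mu.-integrable B (EFin \o f) ->
  \int[mu]_(x in A) f x <= \int[mu]_(x in B) f x.
Proof.
move=> mA mB AB f0 intf; apply: fine_le.
- by apply: integrable_fin_num => //; exact: integrableS intf.
- exact: integrable_fin_num.
- apply: ge0_subset_integral => //.
  by have /integrableP[] := intf.
Qed.

(** The Cauchy-Schwarz inequality for h t and 1 / t: the integral of t^-2 over
[x, y] is at most 1 / x. *)
Lemma density_oscillation u h x y : is_density u h -> bessel_dom u -> 0 < x -> x <= y ->
  (u y - u x) ^+ 2 <= bessel_form u u / x.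
Proof.
move=> uh du x0 xy; have [mh _ hP] := uh; have [ih uE] := hP _ _ x0 xy.
have [iC CE] : mu.-integrable `[x, y] (EFin \o (fun t : R => t ^-2)) /\
    \int[mu]_(t in `[x, y]) t ^-2 = - y^-1 - - x^-1.
  apply: (@is_density_FTC (fun x => - x^-1) _ _ _ _ _ _ x0 xy).
  - have := loc_abs_continuous_lin (-1) 0 loc_abs_continuous_inv loc_abs_continuous_inv.
    congr loc_abs_continuous; apply/funext => t; rewrite mul0r addr0 mulN1r//.
  - have oI : open I by exact: interval_open.
    apply: (open_continuous_measurable_fun oI) => t; rewrite inE halflineE => t0.
    apply: cvgV; first by rewrite expf_neq0 ?gt_eqF.
    exact: exprn_continuous.
  - move=> t t0; have tn0 : id t != 0 by rewrite gt_eqF.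
    have d1 : is_derive t 1 (fun y : R => (id y)^-1) (- (id t) ^- 2 *: 1).
      exact: is_deriveV.
    have := is_deriveN d1; congr (is_derive _ _ _ _).
    by rewrite /= scaleNr opprK [_%:A]mulr1.
have iA : mu.-integrable `[x, y] (EFin \o (fun t => h t ^+ 2 * t ^+ 2)).
  apply: integrableS (bessel_dom_integrable_form du uh) => //.
  exact: (@itv_sub_halfline _ _ x0).
set A := \int[mu]_(t in `[x, y]) (h t ^+ 2 * t ^+ 2).
have AE : A <= bessel_form u u.
  rewrite (bessel_form_density uh uh).
  have -> : \int[mu]_(t in I) (h t * h t * t ^+ 2) =
      \int[mu]_(t in I) (h t ^+ 2 * t ^+ 2).
    by apply: eq_Rintegral => t _; rewrite -expr2.
  apply: (le_Rintegral_subset (measurable_itv _) measurable_halfline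
    (@itv_sub_halfline _ _ x0) _ (bessel_dom_integrable_form du uh)).
  by move=> t _; rewrite mulr_ge0 ?sqr_ge0.
(* The integral of (h t * t - s / t)^2 over [x, y]. *)
have quad s : 0 <= A - 2 * s * (u y - u x) + s ^+ 2 * (x^-1 - y^-1).
  have -> : x^-1 - y^-1 = - y^-1 - - x^-1 by ring.
  rewrite -CE uE /A.
  have mxy : measurable (`[x, y]%classic : set (measurableTypeR R)).
    exact: measurable_itv.
  have i1 := integrableZl mxy (- (2 * s)) ih.
  have i2 := integrableZl mxy (s ^+ 2) iC.
  have E1 := RintegralZl (- (2 * s)) mxy ih.
  have E2 := RintegralZl (s ^+ 2) mxy iC.
  rewrite -mulNr -E1 -E2 -RintegralD// -RintegralD//.
  + apply: Rintegral_ge0 => t /= ; rewrite in_itv/= => /andP[xt _].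
    have t0 : t != 0 by rewrite gt_eqF// (lt_le_trans x0).
    have -> : h t ^+ 2 * t ^+ 2 + - (2 * s) * h t + s ^+ 2 * t ^- 2 =
      (h t * t - s / t) ^+ 2 by field.
    exact: sqr_ge0.
  + exact: (integrableD _ iA i1).
have y0 := lt_le_trans x0 xy.
have C0 : x^-1 - y^-1 <= x^-1 by rewrite gerBl invr_ge0 ltW.
have xi0 : 0 < x^-1 by rewrite invr_gt0.
have E0 := bessel_form_ge0 u.
(* With 1 / x in place of 1 / x - 1 / y, this s minimizes the polynomial. *)
have := quad ((u y - u x) * x).
have : ((u y - u x) * x) ^+ 2 * (x^-1 - y^-1) <= ((u y - u x) * x) ^+ 2 * x^-1.
  by rewrite ler_wpM2l ?sqr_ge0.
have -> : ((u y - u x) * x) ^+ 2 * x^-1 = (u y - u x) ^+ 2 * x.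
  by field; rewrite gt_eqF.
have -> : 2 * ((u y - u x) * x) * (u y - u x) = 2 * ((u y - u x) ^+ 2 * x) by ring.
move=> h1 h2; rewrite ler_pdivlMr//; lra.
Qed.

(** Otherwise u^2 x^2 would be bounded from below on a half-line, and so not be
integrable. *)
Lemma bessel_dom_small u (eps N : R) : bessel_dom u -> 0 < eps ->
  exists2 y, N <= y & `|u y| < eps.
Proof.
move=> du e0; apply: contrapT => /forall2NP H.
have intu := bessel_dom_integrable_inner du.
pose M := Num.max 1 N; have M1 : 1 <= M by rewrite le_max lexx.
have M0 : 0 < M by rewrite (lt_le_trans _ M1).
pose B := \int[mu]_(x in I) (u x ^+ 2 * (2 * x ^+ 2)).
have key (n : R) : 0 <= n -> eps ^+ 2 * 2 * n <= B.
  move=> n0.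
  apply: le_trans (_ : _ <= \int[mu]_(x in `[M, M + n]) (u x ^+ 2 * (2 * x ^+ 2))) _.
    have L : lebesgue_measure (`[M, M + n]%classic : set R) = n%:E.
      rewrite lebesgue_measure_itv/= lte_fin; case: ifPn => [_|].
        by rewrite -EFinB; congr EFin; ring.
      by rewrite ltrDl -leNgt => n0'; congr EFin; apply/eqP; rewrite eq_le n0 n0'.
    have mJ : measurable (`[M, M + n]%classic : set (measurableTypeR R)).
      exact: measurable_itv.
    have -> : eps ^+ 2 * 2 * n = \int[mu]_(_ in `[M, M + n]) (eps ^+ 2 * 2).
      rewrite (Rintegral_cst _ mJ).
      transitivity (eps ^+ 2 * 2 *
        fine (lebesgue_measure (`[M, M + n]%classic : set R))) => //.
      by rewrite L.
    pose J : set (measurableTypeR R) := `[M, M + n]%classic.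
    apply: (le_Rintegral mJ).
    - apply/integrableP; split; first exact: measurable_cst.
      have -> : (\int[mu]_(x in J) `|(eps ^+ 2 * 2)%:E|)%E =
          ((eps ^+ 2 * 2)%:E * mu J)%E.
        rewrite -integral_cst//; apply: eq_integral => t _.
        by rewrite gee0_abs// lee_fin mulr_ge0 ?sqr_ge0.
      have LJ : mu J = n%:E by exact: L.
      by rewrite LJ -EFinM ltry.
    - by apply: (integrableS measurable_halfline mJ (@itv_sub_halfline _ _ M0)).
    - move=> x; rewrite /= in_itv/= => /andP[Mx _].
      have [/negP|/negP] := H x; first by rewrite -ltNge ltNge (le_trans _ Mx) ?le_max ?lexx ?orbT.
      rewrite -leNgt => ux.
      have x1 : 1 <= x ^+ 2 by rewrite exprn_ege1// (le_trans M1).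
      rewrite ler_pM ?sqr_ge0//; last by lra.
      by rewrite -[leRHS]real_normK ?num_real// lerXn2r ?nnegrE ?(ltW e0).
  apply: (le_Rintegral_subset (measurable_itv _) measurable_halfline
    (@itv_sub_halfline _ _ M0) _ intu).
  by move=> x _; rewrite mulr_ge0 ?sqr_ge0// mulr_ge0 ?sqr_ge0.
have B0 : 0 <= B by have := key 0 (lexx _); rewrite mulr0.
have c0 : 0 < eps ^+ 2 * 2 by rewrite mulr_gt0// exprn_gt0.
have := key ((B + 1) / (eps ^+ 2 * 2)).
rewrite divr_ge0 ?addr_ge0 ?(ltW c0)// mulrC divfK ?gt_eqF// => /(_ isT).
lra.
Qed.

(** By [density_oscillation], as u is small at some points arbitrarily far out. *)
Lemma bessel_pointwise u x : bessel_dom u -> 0 < x ->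
  `|u x| <= Num.sqrt (bessel_form u u / x).
Proof.
move=> du x0; have [h uh] := bessel_dom_density du.
apply/ler_addgt0Pr => e e0.
have [y xy uy] := bessel_dom_small x du e0.
have O : `|u y - u x| <= Num.sqrt (bessel_form u u / x).
  rewrite -sqrtr_sqr ler_sqrt ?(density_oscillation uh du)//.
  by rewrite divr_ge0 ?bessel_form_ge0 ?(ltW x0).
have -> : u x = u y - (u y - u x) by ring.
by rewrite (le_trans (ler_normB _ _))// addrC lerD// ltW.
Qed.

End Embedding.

(** * Integration by parts against solutions of f'' = K^2 f *)

Section Solutions.
Context {R : realType}.
Implicit Types (lo hi a b x y c d K A B : R) (f g u v w h k F G z : R -> R).
Notation mu := (@lebesgue_measure R).
Notation I := (@halfline R).
Lemma is_derive_continuous F x c : is_derive x 1 F c -> {for x, continuous F}.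
Proof. by move=> [dF _]; exact/differentiable_continuous/derivable1_diffP. Qed.

Lemma continuous_bounded_itv G lo hi : lo <= hi -> continuous G ->
  exists2 K, 0 <= K & forall x, lo <= x -> x <= hi -> `|G x| <= K.
Proof.
move=> lh cG.
have [|c _ cP] := @EVT_max R (fun x => `|G x|) lo hi lh _.
  apply: continuous_subspaceT => x; apply: continuous_comp; first exact: cG.
  exact: norm_continuous.
exists `|G c| => // x lx xh; apply: cP; rewrite in_itv/= lx xh//.
Qed.

Lemma derivative_lipschitz F G lo hi K :
  (forall x, is_derive x 1 F (G x)) -> (forall x, lo <= x -> x <= hi -> `|G x| <= K) ->
  forall x y, lo <= x -> x <= y -> y <= hi -> `|F y - F x| <= K * (y - x).
Proof.
move=> FG GK x y lx xy yh.
have cF : {within `[x, y], continuous F}.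
  by apply: continuous_subspaceT => t; exact: is_derive_continuous (FG t).
have [c + ->] := MVT_segment xy (fun t _ => FG t) cF.
rewrite in_itv/= => /andP[xc cy].
rewrite normrM (ger0_norm (_ : 0 <= y - x)) ?subr_ge0//.
by rewrite ler_wpM2r ?subr_ge0// GK ?(le_trans lx) ?(le_trans cy).
Qed.

Lemma C1_loc_abs_continuous F G : (forall x, is_derive x 1 F (G x)) ->
  continuous G -> loc_abs_continuous F.
Proof.
move=> FG cG; apply: loc_lipschitz_abs_continuous => lo hi l0 lh.
have [K K0 GK] := continuous_bounded_itv lh cG.
by exists K; exact: derivative_lipschitz FG GK.
Qed.

Lemma loc_abs_continuousM u w : loc_abs_continuous u -> loc_abs_continuous w ->
  loc_abs_continuous (fun x => u x * w x).
Proof. by move=> au aw lo hi l0 lh; apply: abs_continuous_onM; auto. Qed.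

(** The product z F is locally absolutely continuous and has the derivative
h F + z G almost everywhere. *)
Lemma integral_by_parts z h F G a b : is_density z h -> loc_abs_continuous z ->
  (forall x, is_derive x 1 F (G x)) -> continuous G -> 0 < a -> a <= b ->
  mu.-integrable `[a, b] (EFin \o (fun x => h x * F x + z x * G x)) /\
  \int[mu]_(x in `[a, b]) (h x * F x + z x * G x) = z b * F b - z a * F a.
Proof.
move=> zh acz FG cG a0 ab.
have acF := C1_loc_abs_continuous FG cG.
have [p zp] := loc_abs_continuous_density (loc_abs_continuousM acz acF).
have [_ _ pP] := zp; have [ip pE] := pP _ _ a0 ab.
have [mh dh _] := zh.
have E : {ae mu, forall x, `[a, b] x ->
    (EFin \o p) x = (EFin \o (fun x => h x * F x + z x * G x)) x}.
  apply: filterS2 (is_density_derive1 zp) dh => x px hx.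
  rewrite /= in_itv/= => /andP[ax _]; have x0 := lt_le_trans a0 ax.
  rewrite -px ?halflineE// derive1E; congr EFin.
  have dz := hx x0; have dF := FG x.
  have dzF : is_derive x 1 (z * F) (z x *: G x + F x *: h x) by exact: is_deriveM.
  rewrite (_ : (fun _ => _) = z * F)//; rewrite derive_val /GRing.scale/=; ring.
have mfun : measurable_fun `[a, b] (fun x => h x * F x + z x * G x).
  have cF : continuous F by move=> x; exact: is_derive_continuous (FG x).
  apply: measurable_funD; apply: measurable_funM.
  - by apply: measurable_funS mh; [exact: measurable_halfline|exact: (@itv_sub_halfline _ _ _ a0)].
  - by apply: measurable_funTS; exact: continuous_measurable_fun.
  - apply: (@measurable_funS _ _ _ _ I); first exact: measurable_halfline.
      exact: (@itv_sub_halfline _ _ _ a0).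
    have oI : open I by exact: interval_open.
    exact: (open_continuous_measurable_fun oI (loc_abs_continuous_continuous acz)).
  - by apply: measurable_funTS; exact: continuous_measurable_fun.
split; last by rewrite pE /Rintegral (eq_integral_ae E).
by apply: ae_integrable E => //; exact/measurable_EFinP.
Qed.

(** The general solution of f'' = K^2 f. *)
Definition sol A B K x : R := A * expR (K * x) + B * expR (- K * x).
(** This is x^2 w' for w = f / x, where f = [sol A B K]; its derivative is
K^2 x f = K^2 x^2 w. *)
Definition flux A B K x : R := x * sol (K * A) (- (K * B)) K x - sol A B K x.

Lemma is_derive_expM c x :
  is_derive x 1 (fun y => expR (c * y)) (c * expR (c * x)).
Proof.
have d1 : is_derive x 1 (fun y : R => c *: y) (c *: 1).
  exact: (is_deriveZ c (is_derive_id x 1)).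
have := @is_derive1_comp R expR (fun y => c * y) x _ _ (is_derive_expR _) d1.
by rewrite [c *: 1]mulr1 mulrC.
Qed.

Lemma is_derive_sol A B K x :
  is_derive x 1 (sol A B K) (sol (K * A) (- (K * B)) K x).
Proof.
have d1 := is_deriveZ A (is_derive_expM K x).
have d2 := is_deriveZ B (is_derive_expM (- K) x).
have := is_deriveD d1 d2; congr (is_derive _ _ _ _).
by rewrite /sol /GRing.scale/=; ring.
Qed.

Lemma is_derive_flux A B K x :
  is_derive x 1 (flux A B K) (K ^+ 2 * x * sol A B K x).
Proof.
have d1 := is_deriveM (is_derive_id x 1)
  (is_derive_sol (K * A) (- (K * B)) K x).
have := is_deriveB d1 (is_derive_sol A B K x); congr (is_derive _ _ _ _).
by rewrite /sol /GRing.scale/=; ring.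
Qed.

Lemma continuous_sol A B K : continuous (sol A B K).
Proof. by move=> x; exact: is_derive_continuous (is_derive_sol A B K x). Qed.

Lemma continuous_flux A B K : continuous (flux A B K).
Proof. by move=> x; exact: is_derive_continuous (is_derive_flux A B K x). Qed.

Lemma continuous_dflux A B K : continuous (fun x => K ^+ 2 * x * sol A B K x).
Proof.
move=> x; apply: cvgM; last exact: continuous_sol.
by apply: cvgM; [exact: cvg_cst|exact: cvg_id].
Qed.

End Solutions.

(** * Tents *)

Section Tents.
Context {R : realType}.
Implicit Types (a b x y c k K : R) (u v w h F G z : R -> R).
Notation mu := (@lebesgue_measure R).
Notation I := (@halfline R).
Lemma ae_neq c : {ae mu, forall x, x != c}.
Proof.
exists [set c]; split; [exact: measurable_set1|exact: lebesgue_measure_set1|].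
by move=> x /= /negP; rewrite negbK => /eqP.
Qed.

(** There is no boundary term at 0: |z x| <= sqrt (E[z] / x) and |F x| <= L x, so
z x * F x tends to 0. *)
Lemma integral_by_parts0 z h F G b L : bessel_dom z -> is_density z h ->
  (forall x, is_derive x 1 F (G x)) -> continuous G -> 0 < b -> 0 <= L ->
  (forall x, 0 < x -> x <= b -> `|F x| <= L * x) ->
  mu.-integrable `]0, b] (EFin \o (fun x => h x * F x + z x * G x)) ->
  \int[mu]_(x in `]0, b]) (h x * F x + z x * G x) = z b * F b.
Proof.
move=> dz zh FG cG b0 L0 FL intf; pose f x := h x * F x + z x * G x.
have [acz _ _] := dz.
apply/eqP; rewrite -subr_eq0 -normr_le0; apply/ler_addgt0Pr => e e0; rewrite add0r.
have m0b : measurable (`]0, b]%classic : set (measurableTypeR R)).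
  exact: measurable_itv.
pose fb := f \_ `]0, b].
have intfb : mu.-integrable `[0, b] (EFin \o fb).
  have : mu.-integrable setT (EFin \o fb).
    by rewrite -restrict_EFin; exact: (integrable_mkcond _ m0b).1.
  by move=> /integrableS; apply.
have lim0 := parameterized_integral_cvg_left b0 intfb.
have E0 := bessel_form_ge0 z.
set E := bessel_form z z in E0.
pose d := (e / 2 / (L + 1)) ^+ 2 / (E + 1).
have L1 : 0 < L + 1 by rewrite ltr_wpDl.
have E1 : 0 < E + 1 by rewrite ltr_wpDl.
have e1 : 0 < e / 2 / (L + 1) by rewrite !divr_gt0.
have d0 : 0 < d by rewrite divr_gt0// exprn_gt0.
near (0 : R)^'+ => x.
have x0 : 0 < x by near: x; exact: nbhs_right_gt.
have xb : x < b by near: x; exact: nbhs_right_lt.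
have xd : x < d by near: x; exact: nbhs_right_lt.
have small1 : `|\int[mu]_(t in `[0, x]) fb t| < e / 2.
  near: x; apply: (@cvgr0_norm_lt _ _ _ (0 : R)^'+); last by rewrite divr_gt0.
  exact: cvg_at_right_filter.
have [_ parts] := integral_by_parts zh acz FG cG x0 (ltW xb).
have intx : mu.-integrable `]0, x] (EFin \o fb).
  by apply: integrableS intfb => //; apply: subset_itv; rewrite bnd_simp// ltW.
have I1 : \int[mu]_(t in `[0, x]) fb t = \int[mu]_(t in `]0, x]) f t.
  rewrite -Rintegral_itv_obnd_cbnd//; apply: eq_Rintegral => t.
  rewrite inE/= in_itv/= => /andP[t0 tx].
  by rewrite /fb patchE mem_set//= in_itv/= t0 (le_trans tx (ltW xb)).
have I2 : \int[mu]_(t in `]0, b]) f t - \int[mu]_(t in `]0, x]) f t =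
    \int[mu]_(t in `]x, b]) f t.
  by apply: Rintegral_itvB => //; rewrite bnd_simp ltW.
have I3 : \int[mu]_(t in `]x, b]) f t = z b * F b - z x * F x.
  rewrite -parts Rintegral_itv_obnd_cbnd//.
  apply: integrableS intf => //; apply: subset_itvr; rewrite bnd_simp//; exact: ltW.
have -> : \int[mu]_(t in `]0, b]) f t - z b * F b =
    \int[mu]_(t in `]0, x]) f t - z x * F x.
  rewrite -[X in X - _ = _](subrK (\int[mu]_(t in `]0, x]) f t)) I2 I3; ring.
rewrite (le_trans (ler_normB _ _))// -I1.
have small2 : `|z x * F x| <= e / 2.
  rewrite normrM.
  have zx := bessel_pointwise dz x0.
  apply: (@le_trans _ _ (Num.sqrt (E / x) * (L * x))).
    by rewrite ler_pM// FL// ltW.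
  have sx : Num.sqrt (E / x) * x <= e / 2 / (L + 1).
    rewrite -[X in _ * X](ger0_norm (ltW x0)) -sqrtr_sqr -sqrtrM; last first.
      by rewrite divr_ge0// ltW.
    rewrite -[leRHS](ger0_norm (ltW e1)) -[leRHS]sqrtr_sqr ler_sqrt ?sqr_ge0//.
    have -> : E / x * x ^+ 2 = E * x by field; rewrite gt_eqF.
    apply: (@le_trans _ _ ((E + 1) * d)).
      by rewrite ler_pM ?(ltW x0) ?(ltW xd)// lerDl.
    by rewrite /d mulrC divfK// gt_eqF.
  rewrite mulrCA (@le_trans _ _ ((L + 1) * (e / 2 / (L + 1))))//.
    by rewrite ler_pM ?lerDl// mulr_ge0 ?sqrtr_ge0// ltW.
  by rewrite mulrC divfK// gt_eqF.
rewrite [leRHS](splitr e) lerD//; exact: ltW.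
Unshelve. all: by end_near. Qed.

(** sinh (K x) *)
Definition shK K : R -> R := sol 2^-1 (- 2^-1) K.
(** cosh (K x) *)
Definition chK K : R -> R := sol 2^-1 2^-1 K.
Definition tent_arg k x : R := Num.max 0 (1 - `|x - k|).
(** Off the points k - 1, k and k + 1, the product x * tent x solves f'' = K^2 f. *)
Definition tent K k x : R := x^-1 * (k / shK K 1 * shK K (tent_arg k x)).

Lemma shK0 K : shK K 0 = 0.
Proof. by rewrite /shK /sol !mulr0 expR0; ring. Qed.

Lemma chK0 K : chK K 0 = 1.
Proof. by rewrite /chK /sol !mulr0 expR0; lra. Qed.

Lemma is_derive_shK K x : is_derive x 1 (shK K) (K * chK K x).
Proof.
have := is_derive_sol 2^-1 (- 2^-1) K x; congr (is_derive _ _ _ _).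
by rewrite /chK /sol; ring.
Qed.

Lemma shK_gt0 K x : 0 < K -> 0 < x -> 0 < shK K x.
Proof.
move=> K0 x0; have Kx : - K * x < K * x by rewrite mulNr; have := mulr_gt0 K0 x0; lra.
have := Kx; rewrite -ltr_expR /shK /sol; lra.
Qed.

Lemma chK_ge1 K x : 1 <= chK K x.
Proof.
rewrite /chK /sol mulNr expRN; have e0 := expR_gt0 (K * x).
set e := expR (K * x) in e0 *.
have -> : 2^-1 * e + 2^-1 * e^-1 = 1 + (e - 1) ^+ 2 / (2 * e).
  by field; rewrite gt_eqF.
by rewrite lerDl divr_ge0 ?sqr_ge0// mulr_ge0// ltW.
Qed.

Lemma tent_arg_itv k x : 0 <= tent_arg k x <= 1.
Proof. by rewrite /tent_arg le_max lexx ge_max ler01 gerBl normr_ge0. Qed.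

Lemma tent_arg_lipschitz k x y : `|tent_arg k y - tent_arg k x| <= `|y - x|.
Proof.
have := ler_dist_dist (x - k) (y - k).
have -> : x - k - (y - k) = x - y by ring.
rewrite /tent_arg [`|y - x|]distrC.
move: `|x - k| `|y - k| `|x - y| => p q r; rewrite ler_norml => /andP[h1 h2].
by rewrite ler_norml /Num.max; do ?case: ifPn; rewrite -?leNgt; lra.
Qed.

(** The argument [tent_arg k] is 1-Lipschitz with values in [0, 1], where sinh has
a bounded derivative. *)
Lemma shK_tent_lipschitz K k : exists2 M, 0 <= M & forall x y,
  `|shK K (tent_arg k y) - shK K (tent_arg k x)| <= M * `|y - x|.
Proof.
have cG : continuous (fun x => K * chK K x).
  move=> x; apply: cvgM; first exact: cvg_cst.
  exact: continuous_sol.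
have [M M0 MP] := @continuous_bounded_itv R _ 0 1 ler01 cG.
exists M => // x y.
have L p q : 0 <= p <= 1 -> 0 <= q <= 1 -> p <= q ->
    `|shK K q - shK K p| <= M * `|q - p|.
  move=> /andP[p0 p1] /andP[q0 q1] pq.
  rewrite [`|q - p|]ger0_norm ?subr_ge0//.
  exact: (derivative_lipschitz (is_derive_shK K) MP).
apply: (@le_trans _ _ (M * `|tent_arg k y - tent_arg k x|)).
  have [xy|/ltW yx] := leP (tent_arg k x) (tent_arg k y).
    by apply: L; rewrite ?tent_arg_itv.
  by rewrite distrC [`|tent_arg k y - _|]distrC; apply: L; rewrite ?tent_arg_itv.
by rewrite ler_wpM2l// tent_arg_lipschitz.
Qed.

Lemma tent_loc_abs_continuous K k : loc_abs_continuous (tent K k).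
Proof.
apply: loc_abs_continuousM; first exact: loc_abs_continuous_inv.
have [M M0 MP] := shK_tent_lipschitz K k.
apply: loc_lipschitz_abs_continuous => lo hi _ _.
exists (`|k / shK K 1| * M) => x y _ xy _.
by rewrite -mulrBr normrM -mulrA ler_wpM2l// (le_trans (MP _ _))// ger0_norm ?subr_ge0.
Qed.

Lemma tent_arg_out k x : 1 <= `|x - k| -> tent_arg k x = 0.
Proof. by move=> xk; apply/max_idPl; rewrite subr_le0. Qed.

Lemma tent_out K k x : 1 <= `|x - k| -> tent K k x = 0.
Proof. by move=> xk; rewrite /tent tent_arg_out// shK0 !mulr0. Qed.

Lemma tent_center K k : 0 < K -> 0 < k -> tent K k k = 1.
Proof.
move=> K0 k0; have s0 := shK_gt0 K0 (ltr01 : 0 < 1 :> R).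
rewrite /tent /tent_arg subrr normr0 subr0 max_r ?ler01//.
by field; rewrite !gt_eqF.
Qed.

Lemma tent_left K k x : k - 1 <= x -> x <= k ->
  tent K k x = x^-1 * (k / shK K 1 * shK K (x - (k - 1))).
Proof.
move=> xk kx; rewrite /tent /tent_arg ler0_norm ?subr_le0// max_r; last by lra.
by congr (_ * (_ * shK K _)); ring.
Qed.

Lemma tent_right K k x : k <= x -> x <= k + 1 ->
  tent K k x = x^-1 * (k / shK K 1 * shK K (k + 1 - x)).
Proof.
move=> xk kx; rewrite /tent /tent_arg ger0_norm ?subr_ge0// max_r; last by lra.
by congr (_ * (_ * shK K _)); ring.
Qed.

(** The function x * tent x is Lipschitz and vanishes at 0.  So both its derivative
x h + tent and its quotient tent by x are bounded. *)
Lemma tent_density_bound K k h : 0 < K -> 1 <= k -> is_density (tent K k) h ->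
  exists2 L, 0 <= L & {ae mu, forall x, 0 < x ->
    [/\ `|x * h x| <= L, `|tent K k x| <= L & (k + 1 < x -> h x = 0)]}.
Proof.
move=> K0 k1 [_ dh _]; have [M M0 MP] := shK_tent_lipschitz K k.
set c := k / shK K 1; pose q x := c * shK K (tent_arg k x).
have qL x y : `|q y - q x| <= `|c| * M * `|y - x|.
  by rewrite /q -mulrBr normrM -mulrA ler_wpM2l.
have tL x : 0 < x -> `|tent K k x| <= `|c| * M.
  move=> x0; have := qL 0 x; rewrite {2}/q tent_arg_out; last first.
    by rewrite sub0r normrN ger0_norm//; lra.
  rewrite shK0 mulr0 !subr0 /tent -/c -/(q x) => qx.
  by rewrite normrM mulrC normfV ler_pdivrMr ?normr_gt0 ?gt_eqF.
exists (2 * (`|c| * M)); first by rewrite !mulr_ge0.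
apply: filterS dh => x dh x0; have dx := dh x0; have tx := tL _ x0.
have c0 : 0 <= `|c| * M by rewrite mulr_ge0.
split; [|lra|].
- have dq : is_derive x 1 (id * tent K k) (x *: h x + tent K k x *: 1).
    exact: is_deriveM.
  have qE y : 0 < y -> (id * tent K k) y = q y.
    move=> y0; change (y * (y^-1 * q y) = q y).
    by rewrite mulrA divff ?mul1r// gt_eqF.
  have dqx : `|x * h x + tent K k x| <= `|c| * M.
    have := is_derive_cvg_quotient dq.
    rewrite [tent K k x *: 1]mulr1 -[x *: h x]/(x * h x) => lim_.
    apply: (cvgr_to_le (cvg_norm lim_)); apply: nearW => n.
    have n0 : 0 < n.+1%:R^-1 :> R by rewrite invr_gt0.
    rewrite !qE ?addr_gt0// normrM ger0_norm//.
    apply: (@le_trans _ _ (n.+1%:R * (`|c| * M * n.+1%:R^-1))).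
      rewrite ler_wpM2l// (le_trans (qL _ _))// addrAC subrr add0r.
      by rewrite [`|n.+1%:R^-1|]ger0_norm// ltW.
    by rewrite mulrCA mulfV ?mulr1// pnatr_eq0.
  have -> : x * h x = x * h x + tent K k x - tent K k x by ring.
  by rewrite (le_trans (ler_normB _ _))//; lra.
- move=> xk; have E : \forall y \near x, cst 0 y = tent K k y.
    apply: filterS (lt_nbhsr xk) => y ky; rewrite tent_out//= ger0_norm; lra.
  have d0 := near_eq_is_derive E (is_derive_cst (0 : R) x 1).
  by rewrite -(@derive_val _ _ _ _ _ _ _ dx) derive_val.
Qed.

Lemma integral_bounded_support (f : R -> R) b (C : R) : measurable_fun I f ->
  (forall x, 0 <= f x) -> 0 <= C ->
  {ae mu, forall x, 0 < x -> f x <= C /\ (b < x -> f x = 0)} ->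
  (\int[mu]_(x in I) (f x)%:E < +oo)%E.
Proof.
move=> mf f0 C0 fC.
pose g := (cst C%:E : R -> \bar R) \_ `]0, b].
have mb : measurable (`]0, b]%classic : set (measurableTypeR R)).
  exact: measurable_itv.
have mg : measurable_fun I g.
  by apply: measurable_funTS; apply/(measurable_restrictT _ mb); exact: measurable_cst.
have g0 x : (0 <= g x)%E by rewrite /g patchE; case: ifP => //; rewrite lee_fin.
have fg : {ae mu, forall x, I x -> ((f x)%:E <= g x)%E}.
  apply: filterS fC => x xP; rewrite halflineE => x0; have [fx fb] := xP x0.
  rewrite /g patchE; have [xb|bx] := leP x b.
    by rewrite mem_set/= ?lee_fin// in_itv/= x0 xb.
  by rewrite fb//; case: ifP; rewrite lee_fin.
have mfE : measurable_fun I (EFin \o f) by exact/measurable_EFinP.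
apply: (@le_lt_trans _ _ (\int[mu]_(x in I) g x)%E).
  apply: (ae_ge0_le_integral measurable_halfline) => //.
  by move=> x _; rewrite lee_fin.
rewrite -integral_mkcondr integral_cst; last exact: measurableI.
pose J : set R := `]0, b]%classic.
have mub : (lebesgue_measure J < +oo)%E.
  by rewrite lebesgue_measure_itv/=; case: ifP; rewrite -?EFinB ltry.
have : (mu (I `&` J) < +oo)%E.
  apply: le_lt_trans mub; apply: le_measure; rewrite ?inE//; exact: measurableI.
rewrite -ge0_fin_numE// => /fineK muE.
change (C%:E * mu (I `&` J) < +oo)%E.
by rewrite -muE -EFinM ltry.
Qed.

Lemma tent_bessel_dom K k : 0 < K -> 1 <= k -> bessel_dom (tent K k).
Proof.
move=> K0 k1; have act := tent_loc_abs_continuous K k.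
have [h th] := loc_abs_continuous_density act; have [mh _ _] := th.
have [L L0 LP] := tent_density_bound K0 k1 th.
have oI : open I by exact: interval_open.
have mt := open_continuous_measurable_fun oI (loc_abs_continuous_continuous act).
split => //.
- apply: (@integral_bounded_support _ (k + 1) (L ^+ 2 * (2 * (k + 1) ^+ 2))).
  + apply: measurable_funM; first exact: measurable_funX.
    exact: measurable_sqr.
  + by move=> x; rewrite mulr_ge0 ?sqr_ge0// mulr_ge0 ?sqr_ge0.
  + by rewrite mulr_ge0 ?sqr_ge0// mulr_ge0 ?sqr_ge0.
  apply: filterS LP => x xP x0; have [_ tL _] := xP x0.
  have out : k + 1 < x -> tent K k x ^+ 2 * (2 * x ^+ 2) = 0.
    move=> kx; rewrite tent_out ?expr0n ?mul0r//= ger0_norm; lra.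
  split => //; have [xk|/out ->] := leP x (k + 1); last first.
    by rewrite mulr_ge0 ?sqr_ge0// mulr_ge0 ?sqr_ge0.
  have h1 : tent K k x ^+ 2 <= L ^+ 2.
    by rewrite -[leLHS]real_normK ?num_real// lerXn2r ?nnegrE.
  have h2 : 2 * x ^+ 2 <= 2 * (k + 1) ^+ 2.
    by rewrite ler_wpM2l// lerXn2r ?nnegrE ?(ltW x0)//; lra.
  apply: ler_pM => //; first exact: sqr_ge0.
  by rewrite mulr_ge0 ?sqr_ge0.
- have -> : (\int[mu]_(x in I) (derive1 (tent K k) x ^+ 2 * x ^+ 2)%:E =
      \int[mu]_(x in I) (h x ^+ 2 * x ^+ 2)%:E)%E.
    apply: eq_integral_ae; apply: filterS (is_density_derive1 th) => x E Ix.
    by rewrite E.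
  apply: (@integral_bounded_support _ (k + 1) (L ^+ 2)).
  + apply: measurable_funM; first exact: measurable_funX.
    exact: measurable_sqr1.
  + by move=> x; rewrite mulr_ge0 ?sqr_ge0.
  + exact: sqr_ge0.
  apply: filterS LP => x xP x0; have [hL _ out] := xP x0.
  split; last by move=> /out ->; rewrite expr0n mul0r.
  by rewrite mulrC -exprMn -[leLHS]real_normK ?num_real// lerXn2r ?nnegrE.
Qed.

End Tents.

(** * Testing the form with a tent *)

Section TentForm.
Context {R : realType}.
Implicit Types (a b x y c k K A B : R) (u v w h F G z : R -> R).
Notation mu := (@lebesgue_measure R).
Notation I := (@halfline R).
(** The integrand of [bessel_form_shift (K ^+ 2 / 2)]. *)
Definition form_density K (z h w l : R -> R) x : R :=
  h x * l x * x ^+ 2 + K ^+ 2 / 2 * (z x * w x * (2 * x ^+ 2)).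

(** The value of [form_density] where w = f / x with f = [sol A B K]; it is the
derivative of z times the flux. *)
Definition sol_density A B K (z h : R -> R) x : R :=
  h x * flux A B K x + z x * (K ^+ 2 * x * sol A B K x).

Lemma form_density_integrable K z h w l : bessel_dom z -> bessel_dom w ->
  is_density z h -> is_density w l ->
  mu.-integrable I (EFin \o form_density K z h w l) /\
  bessel_form_shift (K ^+ 2 / 2) z w = \int[mu]_(x in I) form_density K z h w l x.
Proof.
move=> dz dw zh wl; have i1 := integrable_form2 dz dw zh wl.
have i2 := integrableZl measurable_halfline (K ^+ 2 / 2) (integrable_inner2 dz dw).
split; first exact: (integrableD measurable_halfline i1 i2).
rewrite /bessel_form_shift (bessel_form_density zh wl) /bessel_inner.
rewrite -(RintegralZl _ measurable_halfline (integrable_inner2 dz dw)).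
by rewrite -(RintegralD measurable_halfline i1 i2).
Qed.

Lemma eq_Rintegral_ae (D : set R) (f g : R -> R) :
  {ae mu, forall x, D x -> f x = g x} ->
  \int[mu]_(x in D) f x = \int[mu]_(x in D) g x.
Proof.
move=> fg; rewrite /Rintegral; congr fine; apply: eq_integral_ae.
by apply: filterS fg => x fg Dx; rewrite fg.
Qed.

Lemma sol_density_integral A B K z h a b : bessel_dom z -> is_density z h ->
  0 < a -> a <= b ->
  \int[mu]_(x in `]a, b]) sol_density A B K z h x =
  z b * flux A B K b - z a * flux A B K a.
Proof.
move=> [acz _ _] zh a0 ab.
have [intf <-] := integral_by_parts zh acz (is_derive_flux A B K)
  (@continuous_dflux R A B K) a0 ab.
rewrite Rintegral_itv_obnd_cbnd//.
by apply: integrableS intf => //; exact: subset_itv_oc_cc.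
Qed.

(** If A + B = 0 then the solution vanishes at 0 and is O(x), as is x times its
derivative. *)
Lemma flux_near0 A B K : A + B = 0 -> exists2 L, 0 <= L &
  forall x, 0 < x -> x <= 1 -> `|flux A B K x| <= L * x.
Proof.
move=> AB; have [M M0 MP] := @continuous_bounded_itv R _ 0 1 ler01
  (@continuous_sol R (K * A) (- (K * B)) K).
exists (2 * M); first by rewrite mulr_ge0.
move=> x x0 x1; rewrite /flux (le_trans (ler_normB _ _))//.
have := derivative_lipschitz (is_derive_sol A B K) MP (lexx 0) (ltW x0) x1.
rewrite {2}/sol !mulr0 expR0 !mulr1 AB !subr0 => h1.
have := MP x (ltW x0) x1; rewrite normrM (ger0_norm (ltW x0)) => h2.
have := ler_wpM2l (ltW x0) h2; lra.
Qed.

Lemma sol_density_measurable A B K z h : bessel_dom z -> is_density z h ->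
  measurable_fun I (sol_density A B K z h).
Proof.
move=> /bessel_dom_measurable mz [mh _ _].
apply: measurable_funD; apply: measurable_funM => //.
- by apply: measurable_funTS; apply: continuous_measurable_fun; exact: continuous_flux.
- by apply: measurable_funTS; apply: continuous_measurable_fun; exact: continuous_dflux.
Qed.

Lemma form_density_sol K A B z h w l x : 0 < x ->
  (\forall y \near x, w y = y^-1 * sol A B K y) -> is_derive x 1 w (l x) ->
  form_density K z h w l x = sol_density A B K z h x.
Proof.
move=> x0 wE dw.
have E : \forall y \near x, sol A B K y = (id * w) y.
  near=> y; have wy : w y = y^-1 * sol A B K y by near: y.
  have y0 : 0 < y by near: y; exact: lt_nbhsr.
  by change (sol A B K y = y * w y); rewrite wy mulrA divff ?mul1r// gt_eqF.
have d1 := near_eq_is_derive E (is_derive_sol A B K x).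
have d2 := is_deriveM (is_derive_id x 1) dw.
have lE : sol (K * A) (- (K * B)) K x = x * l x + w x.
  rewrite -(@derive_val _ _ _ _ _ _ _ d1) (@derive_val _ _ _ _ _ _ _ d2).
  by rewrite /GRing.scale/= mulr1.
have wx := nbhs_singleton wE.
rewrite /form_density /sol_density /flux lE wx.
by field; rewrite gt_eqF.
Unshelve. all: by end_near. Qed.

(** On each side of k the integrand is the derivative of z times a flux, so only
boundary terms at k - 1, k and k + 1 remain. *)
Lemma tent_form K k z : 0 < K -> 1 <= k -> bessel_dom z ->
  bessel_form_shift (K ^+ 2 / 2) z (tent K k) =
  2 * k ^+ 2 * (K * chK K 1 / shK K 1) * z k
  - k * (k - 1) * (K / shK K 1) * z (k - 1)
  - k * (k + 1) * (K / shK K 1) * z (k + 1).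
Proof.
move=> K0 k1 dz; have k0 : 0 < k by rewrite (lt_le_trans _ k1).
have dt := tent_bessel_dom K0 k1.
have [h zh] := bessel_dom_density dz; have [l tl] := bessel_dom_density dt.
have [intf ->] := form_density_integrable K dz dt zh tl.
set f := form_density K z h (tent K k) l in intf *.
have s0 := shK_gt0 K0 (ltr01 : 0 < 1 :> R).
pose c := k / shK K 1.
(* Coefficients of the solutions c sinh (K (x - (k - 1))) and
   c sinh (K (k + 1 - x)), which are x * tent x on the two sides of k. *)
pose A1 := c / 2 * expR (- (K * (k - 1))); pose B1 := - (c / 2) * expR (K * (k - 1)).
pose A2 := - (c / 2) * expR (- (K * (k + 1))); pose B2 := c / 2 * expR (K * (k + 1)).
have sol1 x : sol A1 B1 K x = c * shK K (x - (k - 1)).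
  rewrite /A1 /B1 /shK /sol.
  have -> : K * (x - (k - 1)) = K * x + - (K * (k - 1)) by ring.
  have -> : - K * (x - (k - 1)) = - K * x + K * (k - 1) by ring.
  by rewrite !expRD; field.
have dsol1 x : sol (K * A1) (- (K * B1)) K x = c * K * chK K (x - (k - 1)).
  rewrite /A1 /B1 /chK /sol.
  have -> : K * (x - (k - 1)) = K * x + - (K * (k - 1)) by ring.
  have -> : - K * (x - (k - 1)) = - K * x + K * (k - 1) by ring.
  by rewrite !expRD; field.
have sol2 x : sol A2 B2 K x = c * shK K (k + 1 - x).
  rewrite /A2 /B2 /shK /sol.
  have -> : K * (k + 1 - x) = - K * x + K * (k + 1) by ring.
  have -> : - K * (k + 1 - x) = K * x + - (K * (k + 1)) by ring.
  by rewrite !expRD; field.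
have dsol2 x : sol (K * A2) (- (K * B2)) K x = - (c * K * chK K (k + 1 - x)).
  rewrite /A2 /B2 /chK /sol.
  have -> : K * (k + 1 - x) = - K * x + K * (k + 1) by ring.
  have -> : - K * (k + 1 - x) = K * x + - (K * (k + 1)) by ring.
  by rewrite !expRD; field.
have sol0 x : sol 0 0 K x = 0 by rewrite /sol !mul0r addr0.
have dens0 x : sol_density 0 0 K z h x = 0.
  by rewrite /sol_density /flux mulr0 oppr0 sol0 !mulr0 subr0 mulr0 addr0.
have [_ dl _] := tl.
have fE1 : {ae mu, forall x, `]k - 1, k] x -> f x = sol_density A1 B1 K z h x}.
  apply: filterS2 dl (ae_neq k) => x dl xk /=; rewrite in_itv/= => /andP[kx xk'].
  have {xk xk'} xk : x < k by rewrite lt_neqAle xk.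
  have x0 : 0 < x by lra.
  apply: form_density_sol => //; last exact: dl.
  near=> y; rewrite sol1 -/c tent_left//.
    by near: y; exact: lt_le_nbhsr.
  by near: y; exact: lt_le_nbhsl.
have fE2 : {ae mu, forall x, `]k, k + 1] x -> f x = sol_density A2 B2 K z h x}.
  apply: filterS2 dl (ae_neq (k + 1)) => x dl xk /=; rewrite in_itv/= => /andP[kx xk'].
  have {xk xk'} xk : x < k + 1 by rewrite lt_neqAle xk.
  have x0 : 0 < x by lra.
  apply: form_density_sol => //; last exact: dl.
  near=> y; rewrite sol2 -/c tent_right//.
    by near: y; exact: lt_le_nbhsr.
  by near: y; exact: lt_le_nbhsl.
have fE0 : {ae mu, forall x, `]0, k - 1] x -> f x = 0}.
  apply: filterS2 dl (ae_neq (k - 1)) => x dl xk /=; rewrite in_itv/= => /andP[x0 xk'].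
  have {xk xk'} xk : x < k - 1 by rewrite lt_neqAle xk.
  rewrite -(dens0 x); apply: form_density_sol => //; last exact: dl.
  near=> y; rewrite sol0 mulr0 tent_out//.
  have : y < k - 1 by near: y; exact: lt_nbhsl.
  by move=> yk; rewrite ler0_norm; lra.
have fE3 : {ae mu, forall x, `]k + 1, +oo[ x -> f x = 0}.
  apply: filterS dl => x dl /=; rewrite in_itv/= andbT => kx.
  have x0 : 0 < x by lra.
  rewrite -(dens0 x); apply: form_density_sol => //; last exact: dl.
  near=> y; rewrite sol0 mulr0 tent_out//.
  have : k + 1 < y by near: y; exact: lt_nbhsr.
  by move=> yk; rewrite ger0_norm; lra.
have fl1 x : flux A1 B1 K x = x * (c * K * chK K (x - (k - 1))) - c * shK K (x - (k - 1)).
  by rewrite /flux dsol1 sol1.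
have fl2 x : flux A2 B2 K x = x * - (c * K * chK K (k + 1 - x)) - c * shK K (k + 1 - x).
  by rewrite /flux dsol2 sol2.
have e1 : k - (k - 1) = 1 by ring.
have e2 : k + 1 - k = 1 by ring.
have km0 : 0 <= k - 1 by rewrite subr_ge0.
have sub b : `]0, b] `<=` I by move=> x; rewrite /= in_itv/= halflineE => /andP[].
have split3 : \int[mu]_(x in I) f x = \int[mu]_(x in `]0, k + 1]) f x.
  apply/eqP; rewrite -subr_eq0.
  rewrite (@Rintegral_itvB R f (BRight 0) +oo%O (k + 1) intf) ?bnd_simp//; last by lra.
  by rewrite (eq_Rintegral_ae fE3) /Rintegral integral0.
have int0b b : mu.-integrable `]0, b] (EFin \o f).
  by apply: integrableS intf => //; exact: sub.
have split2 : \int[mu]_(x in `]0, k + 1]) f x = \int[mu]_(x in `]0, k]) f x +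
    (z (k + 1) * flux A2 B2 K (k + 1) - z k * flux A2 B2 K k).
  have := @Rintegral_itvB R f (BRight 0) (BRight (k + 1)) k (int0b _).
  rewrite !bnd_simp => /(_ (ltW k0)) H.
  rewrite -(sol_density_integral _ _ _ dz zh k0); last by lra.
  rewrite -(eq_Rintegral_ae fE2) -H; [ring|lra].
have split1 : \int[mu]_(x in `]0, k]) f x =
    z k * flux A1 B1 K k - z (k - 1) * flux A1 B1 K (k - 1).
  (* The left side of k = 1 reaches the singular endpoint 0. *)
  move: km0; rewrite le_eqVlt => /orP[/eqP km0|km0].
    have k1' : k = 1 by lra.
    have fE1' : {ae mu, forall x, `]0, k] x -> f x = sol_density A1 B1 K z h x}.
      by move: fE1; rewrite -km0.
    rewrite (eq_Rintegral_ae fE1').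
    have AB : A1 + B1 = 0.
      by rewrite /A1 /B1 -km0 mulr0 oppr0 expR0; ring.
    have [L L0 LP] := flux_near0 K AB.
    rewrite (integral_by_parts0 dz zh (is_derive_flux A1 B1 K)
      (@continuous_dflux R A1 B1 K) k0 L0).
    - by rewrite fl1 e1 [flux _ _ _ (k - 1)]fl1 subrr shK0 -km0; ring.
    - by rewrite k1'.
    - have mI0 : measurable (`]0, k]%classic : set (measurableTypeR R)).
        exact: measurable_itv.
      apply: (ae_integrable mI0 _ (int0b k)).
        apply/measurable_EFinP.
        exact: (measurable_funS measurable_halfline (@sub k)
          (sol_density_measurable A1 B1 K dz zh)).
      by apply: filterS fE1' => x E kx; rewrite /= E.
  have := @Rintegral_itvB R f (BRight 0) (BRight k) (k - 1) (int0b _).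
  rewrite !bnd_simp => /(_ (ltW km0)) H.
  rewrite -(sol_density_integral _ _ _ dz zh km0); last by lra.
  rewrite -(eq_Rintegral_ae fE1) -H; last by lra.
  by rewrite (eq_Rintegral_ae fE0) [X in _ = _ - X]/Rintegral integral0 subr0.
rewrite split3 split2 split1 !fl1 !fl2 e1 e2 !subrr shK0 chK0 /c.
by field; rewrite gt_eqF.
Unshelve. all: by end_near. Qed.


End TentForm.

(** * Weighted square-summable sequences *)

Section SequenceSpaceLemmas.
Context {R : realType}.
Variable a : nat -> R.
Hypothesis ha : forall k, 0 < a k.
Implicit Types (f g u v w : nat -> R).

Definition delta_seq (m : nat) : nat -> R := fun j => (j == m)%:R.

Lemma l2sq_term_ge0 u k : (0 <= (a k * u k ^+ 2)%:E)%E.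
Proof. by rewrite lee_fin mulr_ge0 ?sqr_ge0// ltW. Qed.

Lemma l2sq_ge0 u : (0 <= l2sq a u)%E.
Proof. by apply: nneseries_ge0 => k _ _; exact: l2sq_term_ge0. Qed.

Lemma l2sq_term_le u k : ((a k * u k ^+ 2)%:E <= l2sq a u)%E.
Proof.
apply: (@le_trans _ _ (\sum_(0 <= i < k.+1) (a i * u i ^+ 2)%:E)%E).
  rewrite big_nat_recr//= leeDr// sume_ge0// => i _; exact: l2sq_term_ge0.
by apply: nneseries_lim_ge => i _ _; exact: l2sq_term_ge0.
Qed.

Lemma l2_lin c d u w : l2 a u -> l2 a w -> l2 a (fun k => c * u k + d * w k).
Proof.
rewrite /l2/= => uf wf.
apply: (@le_lt_trans _ _ ((2 * c ^+ 2)%:E * l2sq a u + (2 * d ^+ 2)%:E * l2sq a w)%E).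
  rewrite /l2sq -!nneseriesZl; [|by move=> k _; exact: l2sq_term_ge0..].
  rewrite -nneseriesD; last 2 first.
  - by move=> k _ _; rewrite mule_ge0 ?l2sq_term_ge0// lee_fin mulr_ge0 ?sqr_ge0.
  - by move=> k _ _; rewrite mule_ge0 ?l2sq_term_ge0// lee_fin mulr_ge0 ?sqr_ge0.
  apply: lee_nneseries => [k _ _|k _].
    exact: (l2sq_term_ge0 (fun k => c * u k + d * w k)).
  rewrite -!EFinM -EFinD lee_fin.
  have := ltW (ha k); set p := c * u k; set q := d * w k => ak.
  have -> : 2 * c ^+ 2 * (a k * u k ^+ 2) + 2 * d ^+ 2 * (a k * w k ^+ 2) =
    a k * (2 * p ^+ 2 + 2 * q ^+ 2) by rewrite /p /q; ring.
  by rewrite ler_wpM2l//; have := sqr_ge0 (p - q); nra.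
have fin (x : \bar R) : (x < +oo)%E -> (0 <= x)%E -> x \is a fin_num.
  by move=> ? ?; rewrite ge0_fin_numE.
rewrite -(fineK (fin _ uf (l2sq_ge0 u))) -(fineK (fin _ wf (l2sq_ge0 w))).
by rewrite -!EFinM -EFinD ltry.
Qed.

Lemma l2_finite_support u m : (forall k, (m <= k)%N -> u k = 0) -> l2 a u.
Proof.
move=> u0; rewrite /l2/= /l2sq (nneseries_split 0 m); last first.
  by move=> k _; exact: l2sq_term_ge0.
rewrite [X in (_ + X)%E]eseries0; last first.
  by move=> k mk _; rewrite u0 ?expr0n ?mulr0// -[m]add0n.
by rewrite adde0 sumEFin ltry.
Qed.

Lemma l2_delta m : l2 a (delta_seq m).
Proof.
apply: (@l2_finite_support _ m.+1) => k mk.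
by rewrite /delta_seq gtn_eqF.
Qed.

Lemma l2sq_partial u n : l2 a u ->
  \sum_(0 <= k < n) a k * u k ^+ 2 <= fine (l2sq a u).
Proof.
move=> ul; rewrite -lee_fin fineK; last by rewrite ge0_fin_numE// l2sq_ge0.
rewrite -sumEFin; apply: nneseries_lim_ge => k _ _; exact: l2sq_term_ge0.
Qed.

Lemma l2inner_partial (t : R) u w n : 0 < t -> l2 a u -> l2 a w ->
  \sum_(0 <= k < n) `|a k * u k * w k| <=
  (fine (l2sq a u) / t + t * fine (l2sq a w)) / 2.
Proof.
move=> t0 ul wl.
apply: (@le_trans _ _ ((\sum_(0 <= k < n) a k * u k ^+ 2) / t / 2 +
   (t * \sum_(0 <= k < n) a k * w k ^+ 2) / 2)).
  rewrite mulr_sumr !mulr_suml -big_split/=; apply: ler_sum => k _.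
  have ak := ltW (ha k).
  have -> : a k * u k ^+ 2 / t / 2 + t * (a k * w k ^+ 2) / 2 =
     a k * ((u k ^+ 2 / t + t * w k ^+ 2) / 2) by field; rewrite gt_eqF.
  rewrite -mulrA normrM (ger0_norm ak) ler_wpM2l//.
  have E : (u k ^+ 2 / t + t * w k ^+ 2) / 2 - u k * w k = (u k - t * w k) ^+ 2 / (2 * t).
    by field; rewrite gt_eqF.
  have E' : (u k ^+ 2 / t + t * w k ^+ 2) / 2 + u k * w k = (u k + t * w k) ^+ 2 / (2 * t).
    by field; rewrite gt_eqF.
  have p1 : 0 <= (u k - t * w k) ^+ 2 / (2 * t) by rewrite divr_ge0 ?sqr_ge0// mulr_ge0// ltW.
  have p2 : 0 <= (u k + t * w k) ^+ 2 / (2 * t) by rewrite divr_ge0 ?sqr_ge0// mulr_ge0// ltW.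
  by rewrite ler_norml; apply/andP; split; lra.
rewrite mulrDl lerD// ler_wpM2r ?invr_ge0//.
  by rewrite ler_wpM2r ?invr_ge0 ?(ltW t0)// l2sq_partial.
by rewrite ler_wpM2l ?(ltW t0)// l2sq_partial.
Qed.

Lemma l2inner_cvg u w : l2 a u -> l2 a w -> cvgn (series (fun k => a k * u k * w k)).
Proof.
move=> ul wl; apply: normed_cvg; apply: nondecreasing_is_cvgn.
  by apply: nondecreasing_series => k _ _; exact: normr_ge0.
exists ((fine (l2sq a u) / 1 + 1 * fine (l2sq a w)) / 2) => _ [n _ <-].
exact: l2inner_partial.
Qed.

(** By the Cauchy-Schwarz inequality. *)
Lemma l2_strong_weak (un : nat -> nat -> R) u :
  (forall n, l2 a (un n)) -> l2 a u -> l2_strong_cvg a un u -> l2_weak_cvg a un u.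
Proof.
move=> unl ul /fine_cvgP[_ un0] w wl; apply/cvgrPdist_le => e e0.
pose W := fine (l2sq a w); have W0 : 0 <= W by rewrite fine_ge0// l2sq_ge0.
(* The weight t in |x w| <= (x^2 / t + t w^2) / 2 makes the second term small. *)
pose t := e / (W + 1); have t0 : 0 < t by rewrite divr_gt0// ltr_wpDl.
near=> n.
have dl : l2 a (fun k => un n k - u k).
  have := l2_lin 1 (-1) (unl n) ul; congr l2.
  by apply/funext => k; rewrite mul1r mulN1r.
have small : fine (l2sq a (fun k => un n k - u k)) < e * t.
  near: n; have et0 : 0 < e * t by rewrite mulr_gt0.
  move/cvgrPdist_lt : un0 => /(_ _ et0); apply: filterS => n /=.
  by rewrite sub0r normrN; apply: le_lt_trans; exact: ler_norm.
have -> : l2inner a u w - l2inner a (un n) w =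
   - limn (series (fun k => a k * (un n k - u k) * w k)).
  rewrite /l2inner; have c1 := l2inner_cvg (unl n) wl; have c2 := l2inner_cvg ul wl.
  rewrite -opprB; congr (- _); apply/esym/cvg_lim => //.
  have -> : series (fun k => a k * (un n k - u k) * w k) =
      (fun m => series (fun k => a k * un n k * w k) m -
                series (fun k => a k * u k * w k) m).
    apply/funext => m; rewrite /series/= -sumrB; apply: eq_bigr => k _; ring.
  exact: cvgB c1 c2.
rewrite normrN -lim_norm; last exact: l2inner_cvg.
apply: limr_le.
  by apply: is_cvg_norm; exact: l2inner_cvg.
apply: nearW => m; rewrite /series/= (le_trans (ler_norm_sum _ _ _))//.
apply: le_trans (l2inner_partial m t0 dl wl) _.
have h1 : fine (l2sq a (fun k => un n k - u k)) / t <= e.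
  by rewrite ler_pdivrMr// ltW.
have h2 : t * fine (l2sq a w) <= e.
  rewrite /t -/W mulrAC ler_pdivrMr ?ltr_wpDl// ler_wpM2l ?(ltW e0)// lerDl//.
lra.
Unshelve. all: by end_near. Qed.

Lemma l2_strong_pointwise (un : nat -> nat -> R) u k :
  l2_strong_cvg a un u -> (fun n => un n k) @ \oo --> u k.
Proof.
move=> /fine_cvgP[fin un0]; apply/cvgrPdist_lt => e e0.
have e1 : 0 < a k * e ^+ 2 by rewrite mulr_gt0// exprn_gt0.
near=> n.
have f1 : l2sq a (fun j => un n j - u j) \is a fin_num by near: n.
have small : fine (l2sq a (fun j => un n j - u j)) < a k * e ^+ 2.
  near: n; move/cvgrPdist_lt : un0 => /(_ _ e1); apply: filterS => n /=.
  by rewrite sub0r normrN; apply: le_lt_trans; exact: ler_norm.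
have := l2sq_term_le (fun j => un n j - u j) k.
rewrite -(fineK f1) lee_fin => /le_lt_trans/(_ small).
rewrite ltr_pM2l// distrC => h.
by rewrite -(ltr_pXn2r (_ : (0 < 2)%N)) ?nnegrE ?(ltW e0)// real_normK ?num_real.
Unshelve. all: by end_near. Qed.

End SequenceSpaceLemmas.

(** * Upper and lower limits *)

Section LimInfSup.
Context {R : realType}.
Implicit Types (x : nat -> \bar R) (M : \bar R).

Lemma limn_esup_lt_near x M : (limn_esup x < M)%E -> \forall n \near \oo, (x n < M)%E.
Proof.
rewrite limn_esup_lim => xM.
have E := cvg_lim (@ereal_hausdorff R) (@cvg_esups_inf R x); rewrite E in xM.
have [_ [N _ <-] NM] := ereal_inf_lt xM.
exists N => // n /= Nn; apply: le_lt_trans NM.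
by apply: ereal_sup_ubound; exists n.
Qed.

Lemma limn_einf_le_near x M : (\forall n \near \oo, (x n <= M)%E) -> (limn_einf x <= M)%E.
Proof.
move=> [N _ NM]; rewrite limn_einf_lim; apply: lime_le; first exact: is_cvg_einfs.
apply: nearW => n; apply: ge_ereal_inf; exists (x (maxn n N)).
  by exists (maxn n N) => //=; exact: leq_maxl.
by apply: NM => /=; exact: leq_maxr.
Qed.

End LimInfSup.

(** * The trace of the shifted form *)

Section TraceShift.
Context {R : realType}.
Variable a : nat -> R.
Hypothesis ha : forall k, 0 < a k.
Implicit Types (v : nat -> R) (K s sg : R) (m : nat) (u p z w : R -> R).

Definition coef_diag K : R := K * chK K 1 / shK K 1.
Definition coef_off K : R := K / shK K 1.

(** For C = K coth K and S = K / sinh K this is the value of the shifted form on z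
and the tent at m + 1, where v lists the values of z at the integers.  For
m = 0 the coefficient of v m.-1 vanishes. *)
Definition discrete_flux (C S : R) m v : R :=
  2 * m.+1%:R ^+ 2 * C * v m - m.+1%:R * m%:R * S * v m.-1
  - m.+1%:R * m.+2%:R * S * v m.+1.

Lemma discrete_flux_delta (C S : R) m :
  discrete_flux C S m (delta_seq m) = 2 * m.+1%:R ^+ 2 * C.
Proof.
rewrite /discrete_flux /delta_seq eqxx [m.+1 == m]gtn_eqF//.
case: m => [|m] /=; first by rewrite !mulr0 mul0r; ring.
by rewrite ltn_eqF// !mulr0 mulr1 !subr0.
Qed.

Lemma coef_off_gt0 K : 0 < K -> 0 < coef_off K.
Proof. by move=> K0; rewrite divr_gt0// shK_gt0. Qed.

Lemma coef_off_le_diag K : 0 < K -> coef_off K <= coef_diag K.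
Proof.
move=> K0; rewrite /coef_diag mulrAC -/(coef_off K).
by rewrite ler_peMr ?chK_ge1// ltW// coef_off_gt0.
Qed.

Notation tentN K m := (tent K m.+1%:R).

Lemma tentN_dom K m : 0 < K -> bessel_dom (tentN K m).
Proof. by move=> K0; apply: tent_bessel_dom; rewrite ?ler1n. Qed.

Lemma restrN_tentN K m : 0 < K -> restrN (tentN K m) = delta_seq m.
Proof.
move=> K0; apply/funext => j; rewrite /restrN /delta_seq.
have [->|jm] := eqVneq j m; first by rewrite tent_center.
rewrite tent_out//; move: jm; rewrite neq_lt => /orP[] jm.
  by rewrite ltr0_norm ?subr_lt0 ?ltr_nat// opprB lerBrDr addrC natr1 ler_nat.
by rewrite gtr0_norm ?subr_gt0 ?ltr_nat// lerBrDr addrC natr1 ler_nat.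
Qed.

Lemma tentN_form K m z : 0 < K -> bessel_dom z ->
  bessel_form_shift (K ^+ 2 / 2) z (tentN K m) =
  discrete_flux (coef_diag K) (coef_off K) m (restrN z).
Proof.
move=> K0 dz; rewrite tent_form ?ler1n// /discrete_flux /restrN -/(coef_diag K) -/(coef_off K).
have -> : m.+1%:R - 1 = m%:R :> R by rewrite -natr1 addrK.
rewrite natr1; case: m => [|m] //=.
by rewrite mulr0 !mul0r.
Qed.

Lemma tentN_orth K m : 0 < K -> orth_compl (K ^+ 2 / 2) kerJ (tentN K m).
Proof.
move=> K0; split; first exact: tentN_dom.
move=> w [dw w0]; rewrite bessel_form_shiftC tentN_form// /discrete_flux !w0.
by rewrite !mulr0 !subr0.
Qed.

(** The sequence y m = (m+1) v m satisfies 2 C y m = S (y (m-1) + y (m+1)), with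
y (-1) = 0.  Since C >= S, the increments of y do not decrease as long as
y >= 0, so y m >= (m+1) y 0 if y 0 >= 0.  Then |v m| >= |v 0|, and the decay of
v forces v 0 = 0. *)
Lemma discrete_flux_eq0 (C S B : R) v : 0 < S -> S <= C ->
  (forall m, discrete_flux C S m v = 0) ->
  (forall m, v m ^+ 2 * m.+1%:R <= B) -> forall m, v m = 0.
Proof.
move=> S0 SC vE vB; pose y m : R := m.+1%:R * v m.
have rec0 : 2 * C * y 0%N = S * y 1%N.
  have := vE 0%N; rewrite /discrete_flux /y mulr0 !mul0r subr0 !mul1r expr1n; lra.
have recS m : 2 * C * y m.+1 = S * (y m + y m.+2).
  have := vE m.+1; rewrite /discrete_flux /= => E.
  have n0 : m.+2%:R != 0 :> R by rewrite pnatr_eq0.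
  apply: (mulfI n0); rewrite /y; move: E.
  move: (m.+2%:R : R) (m.+1%:R : R) (m.+3%:R : R) => q r t E.
  apply/eqP; rewrite -subr_eq0; apply/eqP; rewrite -[RHS]E; ring.
have grow (w : nat -> R) : 2 * C * w 0%N = S * w 1%N ->
    (forall m, 2 * C * w m.+1 = S * (w m + w m.+2)) -> 0 <= w 0%N ->
    forall m, m.+1%:R * w 0%N <= w m.
  move=> w01 wS w0 m.
  suff [_ //] : w 0%N <= w m.+1 - w m /\ m.+1%:R * w 0%N <= w m.
  elim: m => [|m [ih1 ih2]].
    split; last by rewrite mul1r.
    have : S * (2 * w 0%N) <= S * w 1%N by rewrite -w01; nra.
    by rewrite ler_pM2l//; lra.
  have wm1 : 0 <= w m.+1.
    have : 0 <= m.+1%:R * w 0%N by rewrite mulr_ge0.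
    lra.
  split; last by rewrite -natr1 mulrDl mul1r; lra.
  have : S * (2 * w m.+1) <= S * (w m + w m.+2) by rewrite -wS; nra.
  by rewrite ler_pM2l//; lra.
have y00 : y 0%N = 0.
  have ybnd m : m.+1%:R * `|y 0%N| <= `|y m|.
    have [y0|/ltW y0] := leP 0 (y 0%N).
      by rewrite (ger0_norm y0) (le_trans _ (ler_norm _))//; exact: grow.
    rewrite (ler0_norm y0) -normrN (le_trans _ (ler_norm _))//.
    apply: (grow (fun m => - y m)) => [|j|]; rewrite ?mulrN ?rec0 ?recS ?oppr_ge0//; ring.
  have v0m m : v 0%N ^+ 2 * m.+1%:R <= B.
    apply: le_trans (vB m); rewrite ler_wpM2r//.
    rewrite -[leLHS]real_normK ?num_real// -[leRHS]real_normK ?num_real//.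
    rewrite lerXn2r ?nnegrE//; have := ybnd m.
    by rewrite /y mul1r normrM ger0_norm// ler_pM2l// ltr0n.
  suff : v 0%N ^+ 2 = 0 by move/eqP; rewrite sqrf_eq0 => /eqP v0; rewrite /y v0 mulr0.
  apply/eqP; rewrite eq_le sqr_ge0 andbT leNgt; apply/negP => v0.
  have B0 : 0 <= B by apply: le_trans (v0m 0%N); rewrite mulr_ge0// ltW.
  have := v0m (Num.bound (B / v 0%N ^+ 2)); apply/negP; rewrite -ltNge.
  rewrite -ltr_pdivrMl// mulrC.
  apply: lt_le_trans (archi_boundP _) _; first by rewrite divr_ge0// ltW.
  by rewrite ler_nat.
have y0 m : y m = 0 /\ y m.+1 = 0.
  elim: m => [|m [ih1 ih2]].
    split=> //.
    by apply: (mulfI (lt0r_neq0 S0)); rewrite -rec0 y00 !mulr0.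
  split=> //; apply: (mulfI (lt0r_neq0 S0)); rewrite mulr0.
  by have := recS m; rewrite ih1 ih2 mulr0 add0r => <-.
move=> m; have [ym _] := y0 m; apply: (@mulfI _ m.+1%:R); first by rewrite pnatr_eq0.
by rewrite mulr0.
Qed.

Lemma restrN_sq_bound z m : bessel_dom z -> restrN z m ^+ 2 * m.+1%:R <= bessel_form z z.
Proof.
move=> dz; have m0 : 0 < m.+1%:R :> R by rewrite ltr0n.
have E0 := bessel_form_ge0 z.
have := bessel_pointwise dz m0; rewrite -/(restrN z m) => h.
rewrite -ler_pdivlMr// -[leLHS]real_normK ?num_real//.
rewrite -[leRHS]sqr_sqrtr; last by rewrite divr_ge0// ltW.
by rewrite lerXn2r ?nnegrE ?sqrtr_ge0.
Qed.

(** The function u - p is orthogonal to all tents, which belong to the range of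
the projection; so its values at the integers satisfy the recursion of
[discrete_flux_eq0], and they decay by [restrN_sq_bound]. *)
Lemma orth_proj_restrN K u p : 0 < K -> bessel_dom u ->
  is_orth_proj (K ^+ 2 / 2) (orth_compl (K ^+ 2 / 2) kerJ) u p ->
  bessel_dom p /\ restrN p = restrN u.
Proof.
move=> K0 du [[dp _] up]; split => //.
have dz : bessel_dom (fun x => u x - p x).
  have := bessel_dom_lin 1 (-1) du dp; congr bessel_dom.
  by apply/funext => x; rewrite mul1r mulN1r.
have := @discrete_flux_eq0 _ _ _ (restrN (fun x => u x - p x)) (coef_off_gt0 K0)
  (coef_off_le_diag K0) _ (fun m => restrN_sq_bound m dz).
move=> H; apply/funext => m; apply/esym/eqP; rewrite -subr_eq0; apply/eqP/H => j.
by rewrite -tentN_form//; apply: up; exact: tentN_orth.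
Qed.

(** The projection p has the values v at the integers. *)
Lemma trace_shift_ge_point K v m : 0 < K ->
  ((v m ^+ 2)%:E <= trace_shift a (K ^+ 2 / 2) v)%E.
Proof.
move=> K0; apply: le_ereal_inf_tmp => _ [u [p [[du _] uv pr ->]]].
have [dp pu] := orth_proj_restrN K0 du pr; rewrite lee_fin -uv -pu.
have := restrN_sq_bound m dp.
have l0 : 0 <= K ^+ 2 / 2 by rewrite divr_ge0 ?sqr_ge0.
move=> /le_trans /(_ (bessel_form_le_shift p l0)); apply: le_trans.
by rewrite ler_peMr ?sqr_ge0// ler1n.
Qed.

(** If p is the projection of u, then sg p + s tent is that of sg u + s tent.  Its
energy follows from bilinearity and [tentN_form], as p has the values v at the
integers. *)
Lemma trace_shift_perturb K v m sg s : 0 < K -> sg ^+ 2 = 1 ->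
  (trace_shift a (K ^+ 2 / 2) (fun j => (sg * v j + s * delta_seq m j)%R) <=
   trace_shift a (K ^+ 2 / 2) v +
   (2 * sg * s * discrete_flux (coef_diag K) (coef_off K) m v +
    s ^+ 2 * (2 * m.+1%:R ^+ 2 * coef_diag K))%R%:E)%E.
Proof.
move=> K0 sg2; rewrite -leeBlDr//; apply: le_ereal_inf_tmp => _ [u [p [[du lu] uv pr ->]]].
have [dp pu] := orth_proj_restrN K0 du pr.
rewrite leeBlDr//; apply: ereal_inf_lbound.
pose t := tentN K m; have dt : bessel_dom t by exact: tentN_dom.
exists (fun x => sg * u x + s * t x), (fun x => sg * p x + s * t x).
have rE : restrN (fun x => sg * u x + s * t x) = (fun j => sg * v j + s * delta_seq m j).
  by apply/funext => j; rewrite -uv -(@restrN_tentN K m K0).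
have [[_ op] up] := pr.
have [_ ot] := tentN_orth m K0.
split.
- split; first exact: (bessel_dom_lin sg s du dt).
  by rewrite rE; apply: (l2_lin ha _ _ _ (l2_delta ha m)); rewrite -uv.
- exact: rE.
- split; first split; first exact: (bessel_dom_lin sg s dp dt).
    move=> w kw; have [dw _] := kw.
    by rewrite (bessel_form_shift_linl _ sg s dp dt dw) op// ot// !mulr0 addr0.
  move=> w ow; have [dw _] := ow.
  have := up w ow.
  have -> : (fun x => sg * u x + s * t x - (sg * p x + s * t x)) =
      (fun x => sg * (u x - p x) + 0 * t x).
    by apply/funext => x; ring.
  have dup : bessel_dom (fun x => u x - p x).
    have := bessel_dom_lin 1 (-1) du dp; congr bessel_dom.
    by apply/funext => x; rewrite mul1r mulN1r.
  rewrite (bessel_form_shift_linl _ sg 0 dup dt dw).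
  by move=> ->; rewrite mulr0 mul0r addr0.
- rewrite -EFinD; congr EFin.
  have dpt := bessel_dom_lin sg s dp dt.
  have E0 := bessel_form_shift_linl (K ^+ 2 / 2) sg s dp dt dpt.
  have E1 := bessel_form_shift_linl (K ^+ 2 / 2) sg s dp dt dp.
  have E2 := bessel_form_shift_linl (K ^+ 2 / 2) sg s dp dt dt.
  move: E0 E1 E2; set q := (fun x => _) => E0 E1 E2.
  rewrite E0 (bessel_form_shiftC _ p q) (bessel_form_shiftC _ t q) E1 E2.
  rewrite (bessel_form_shiftC _ t p).
  rewrite (tentN_form m K0 dp) (tentN_form m K0 dt) pu uv (restrN_tentN m K0).
  rewrite discrete_flux_delta.
  have -> : sg * (sg * bessel_form_shift (K ^+ 2 / 2) p p + s * discrete_flux (coef_diag K) (coef_off K) m v) =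
    sg ^+ 2 * bessel_form_shift (K ^+ 2 / 2) p p + sg * s * discrete_flux (coef_diag K) (coef_off K) m v by ring.
  by rewrite sg2; ring.
Qed.

Lemma trace_shift_0 K : 0 < K ->
  (trace_shift a (K ^+ 2 / 2) (fun _ => 0%R) <= 0)%E.
Proof.
move=> K0; apply: ereal_inf_lbound; exists (fun _ => 0), (fun _ => 0).
have dt := tentN_dom 0 K0.
have E0 : (fun _ => 0) = (fun x => 0 * tentN K 0 x + 0 * tentN K 0 x).
  by apply/funext => x; rewrite !mul0r addr0.
have d0 : bessel_dom (fun _ : R => 0 : R) by rewrite E0; exact: (bessel_dom_lin 0 0 dt dt).
have f0 w : bessel_dom w -> bessel_form_shift (K ^+ 2 / 2) (fun _ => 0) w = 0.
  by move=> dw; rewrite E0 bessel_form_shift_linl// !mul0r addr0.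
split.
- by split; [exact: d0|apply: (@l2_finite_support _ _ ha _ 0)].
- by [].
- split; first by split; [exact: d0|move=> w [dw _]; exact: f0].
  move=> w [dw _].
  have -> : (fun _ : R => 0 - 0) = (fun _ : R => 0) :> (R -> R).
    by apply/funext => x; rewrite subrr.
  exact: f0.
- by rewrite (f0 _ d0).
Qed.

End TraceShift.

(** * The trace form *)

Section TraceForm.
Context {R : realType}.
Variable a : nat -> R.
Hypothesis ha : forall k, 0 < a k.
Variable E : (nat -> R) -> \bar R.
Hypothesis hE : is_trace_form a E.
Implicit Types (v : nat -> R) (sg s : R) (m : nat).

(** Values of K = sqrt (2 lam) that tend to 0. *)
Notation kap n := (n.+1%:R^-1 : R).

Lemma kap_gt0 n : 0 < kap n. Proof. by rewrite invr_gt0. Qed.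

Lemma shK_sym (K x : R) : shK K x = shK x K.
Proof. by rewrite /shK /sol !mulNr [K * x]mulrC. Qed.

Lemma chK_sym (K x : R) : chK K x = chK x K.
Proof. by rewrite /chK /sol !mulNr [K * x]mulrC. Qed.

Lemma coef_off_cvg : (fun n => coef_off (kap n)) @ \oo --> (1 : R).
Proof.
have := is_derive_cvg_quotient (is_derive_shK (1 : R) 0).
rewrite chK0 mulr1 shK0 => H.
have -> : (fun n => coef_off (kap n)) =
    (fun n => (n.+1%:R * (shK 1 (0 + kap n) - 0))^-1).
  apply/funext => n; rewrite /coef_off add0r subr0 [shK (kap n) 1]shK_sym.
  by rewrite invfM.
by rewrite -[X in _ --> X]invr1; apply: cvgV H; rewrite oner_eq0.
Qed.

Lemma coef_diag_cvg : (fun n => coef_diag (kap n)) @ \oo --> (1 : R).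
Proof.
have -> : (fun n => coef_diag (kap n)) = (fun n => coef_off (kap n) * chK 1 (kap n)).
  by apply/funext => n; rewrite /coef_diag /coef_off [chK (kap n) 1]chK_sym mulrAC.
rewrite -[X in _ --> X]mulr1; apply: cvgM; first exact: coef_off_cvg.
rewrite -[X in _ --> X](chK0 (1 : R)).
by apply: continuous_cvg; [exact: continuous_sol|exact: cvg_harmonic].
Qed.

Lemma mosco : mosco_cvg a (fun n => trace_shift a (kap n ^+ 2 / 2)) E.
Proof.
apply: hE => [n|]; first by rewrite divr_gt0// exprn_gt0// kap_gt0.
have -> : 0 = 0 * 0 / 2 :> R by rewrite !mul0r.
apply: cvgM; last exact: cvg_cst.
by under eq_fun do rewrite expr2; apply: cvgM; exact: cvg_harmonic.
Qed.

(** Along the recovery sequence the energies are eventually below any real number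
above E v. *)
Lemma recovery v (M : R) : l2 a v -> (E v < M%:E)%E -> exists un, [/\
  forall n, l2 a (un n), l2_strong_cvg a un v &
  \forall n \near \oo, (trace_shift a (kap n ^+ 2 / 2) (un n) < M%:E)%E].
Proof.
move=> vl EM; have [un [unl unv sup]] := mosco.2 v vl.
exists un; split => //; apply: limn_esup_lt_near; exact: le_lt_trans EM.
Qed.

Lemma trace_form_lt_sq v m (M : R) : l2 a v -> (E v < M%:E)%E -> v m ^+ 2 <= M.
Proof.
move=> vl EM; have [un [unl unv nM]] := recovery vl EM.
have um := @l2_strong_pointwise R a ha un v m unv.
have um2 : (fun n => un n m ^+ 2) @ \oo --> v m ^+ 2.
  by rewrite expr2; under eq_fun do rewrite expr2; exact: cvgM.
apply: (cvgr_to_le um2); apply: filterS nM => n nM.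
have := trace_shift_ge_point a (un n) m (kap_gt0 n).
by move=> /le_lt_trans/(_ nM); rewrite lte_fin => /ltW.
Qed.

Lemma form_dom_fin v : form_dom a E v -> E v \is a fin_num.
Proof.
move=> [vl Ev]; rewrite fin_numElt Ev andbT ltNye; apply/eqP => ENy.
have := @trace_form_lt_sq v 0%N (-1) vl; rewrite ENy ltNyr => /(_ isT).
by have := sqr_ge0 (v 0%N); lra.
Qed.

Lemma form_dom_sq v m : form_dom a E v -> v m ^+ 2 <= fine (E v).
Proof.
move=> /[dup] /form_dom_fin f [vl Ev]; apply/ler_addgt0Pr => e e0.
apply: trace_form_lt_sq => //; rewrite EFinD fineK// lteDl//.
Qed.

(** The same change is made to a recovery sequence of v.  The result converges
strongly, hence weakly, so the lower bound in the Mosco convergence applies;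
the energies change by amounts that converge. *)
Lemma trace_form_perturb v m sg s : form_dom a E v -> sg ^+ 2 = 1 ->
  (E (fun j => (sg * v j + s * delta_seq m j)%R) <=
   E v + (2 * sg * s * discrete_flux 1 1 m v + s ^+ 2 * (2 * m.+1%:R ^+ 2))%R%:E)%E.
Proof.
move=> /[dup] /form_dom_fin f [vl Ev] sg2; apply/lee_addgt0Pr => e e0.
have e2 : 0 < e / 2 by rewrite divr_gt0.
have EM : (E v < (fine (E v) + e / 2)%:E)%E by rewrite EFinD fineK// lteDl.
have [un [unl unv nM]] := recovery vl EM.
pose w := fun j => sg * v j + s * delta_seq m j.
pose wn n := fun j => sg * un n j + s * delta_seq m j.
have wl : l2 a w by apply: l2_lin => //; exact: l2_delta.
have wnl n : l2 a (wn n) by apply: l2_lin => //; exact: l2_delta.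
have wnw : l2_strong_cvg a wn w.
  rewrite /l2_strong_cvg.
  have -> // : (fun n => l2sq a (fun k => wn n k - w k)) =
    (fun n => l2sq a (fun k => un n k - v k)).
  apply/funext => n; apply: eq_eseriesr => j _; congr EFin.
  have -> : wn n j - w j = sg * (un n j - v j) by rewrite /wn /w; ring.
  by rewrite exprMn sg2 mul1r.
have := mosco.1 wn w wnl wl (l2_strong_weak ha wnl wl wnw).
move=> /le_trans; apply; apply: limn_einf_le_near.
set c := 2 * sg * s * discrete_flux 1 1 m v + s ^+ 2 * (2 * m.+1%:R ^+ 2).
pose cn n := 2 * sg * s * discrete_flux (coef_diag (kap n)) (coef_off (kap n)) m (un n) +
    s ^+ 2 * (2 * m.+1%:R ^+ 2 * coef_diag (kap n)).
have cnc : cn @ \oo --> c.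
  have up j := @l2_strong_pointwise R a ha un v j unv.
  have cC := coef_diag_cvg; have cS := coef_off_cvg.
  apply: cvgD; apply: cvgM; try exact: cvg_cst.
    rewrite /discrete_flux; apply: cvgB; first apply: cvgB.
    - by apply: cvgM => //; apply: cvgM => //; exact: cvg_cst.
    - by apply: cvgM => //; apply: cvgM => //; exact: cvg_cst.
    - by apply: cvgM => //; apply: cvgM => //; exact: cvg_cst.
  by rewrite -[X in _ --> X]mulr1; apply: cvgM => //; exact: cvg_cst.
have cnlt : \forall n \near \oo, cn n < c + e / 2.
  by apply: (cvgr_lt c cnc); rewrite ltrDl.
apply: filterS2 nM cnlt => n nM cnlt.
have := trace_shift_perturb ha (un n) m s (kap_gt0 n) sg2; rewrite -/(cn n).
move=> /le_trans; apply.
apply: (@le_trans _ _ ((fine (E v) + e / 2)%:E + (c + e / 2)%:E)%E).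
  by apply: leeD; [exact: ltW|rewrite lee_fin ltW].
by rewrite -{2}(fineK f) -!EFinD lee_fin; lra.
Qed.

Lemma discrete_flux_lin (C S c d : R) m v (w : nat -> R) :
  discrete_flux C S m (fun j => c * v j + d * w j) =
  c * discrete_flux C S m v + d * discrete_flux C S m w.
Proof. by rewrite /discrete_flux; ring. Qed.

(** The converse inequality is [trace_form_perturb] for the change that restores
v. *)
Lemma trace_form_perturbE v m sg s : form_dom a E v -> sg ^+ 2 = 1 ->
  form_dom a E (fun j => sg * v j + s * delta_seq m j) /\
  fine (E (fun j => sg * v j + s * delta_seq m j)) =
  fine (E v) + 2 * sg * s * discrete_flux 1 1 m v + s ^+ 2 * (2 * m.+1%:R ^+ 2).
Proof.
move=> vd sg2; have fv := form_dom_fin vd; have [vl _] := vd.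
set w := fun j => _; have up := trace_form_perturb m s vd sg2.
rewrite -/w -(fineK fv) -EFinD in up.
have wd : form_dom a E w.
  split; last by apply: le_lt_trans up _; rewrite ltry.
  by apply: l2_lin => //; exact: l2_delta.
have fw := form_dom_fin wd; split => //.
have down := trace_form_perturb m (- (sg * s)) wd sg2.
have wv : (fun j => sg * w j + - (sg * s) * delta_seq m j) = v.
  apply/funext => j; rewrite /w.
  have -> : sg * (sg * v j + s * delta_seq m j) + - (sg * s) * delta_seq m j =
    sg ^+ 2 * v j by ring.
  by rewrite sg2 mul1r.
rewrite wv -(fineK fv) -(fineK fw) -EFinD lee_fin in down.
move: up; rewrite -(fineK fw) lee_fin => up.
move: down; rewrite /w discrete_flux_lin discrete_flux_delta -/w.
have -> : 2 * sg * - (sg * s) * (sg * discrete_flux 1 1 m v + s * (2 * m.+1%:R ^+ 2 * 1)) +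
  (- (sg * s)) ^+ 2 * (2 * m.+1%:R ^+ 2) =
  sg ^+ 2 * (- (2 * sg * s * discrete_flux 1 1 m v) - s ^+ 2 * (2 * m.+1%:R ^+ 2)) by ring.
rewrite sg2 mul1r => down; apply/eqP; rewrite eq_le; apply/andP; split; lra.
Qed.

Lemma form_dom_0 : form_dom a E (fun _ => 0).
Proof.
have z0 : l2 a (fun _ => 0) by apply: (@l2_finite_support _ _ ha _ 0).
split=> //; apply: (@le_lt_trans _ _ 0%E) => //.
have wk : l2_weak_cvg a (fun _ _ => 0) (fun _ => 0) by move=> w _; exact: cvg_cst.
have := mosco.1 _ _ (fun _ => z0) z0 wk.
move=> /le_trans; apply; apply: limn_einf_le_near; apply: nearW => n.
exact: (trace_shift_0 ha (kap_gt0 n)).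
Qed.

Lemma form_dom_delta m : form_dom a E (delta_seq m).
Proof.
have [] := trace_form_perturbE m 1 form_dom_0 (expr1n _ 2); rewrite (_ : (fun _ => _) = delta_seq m)//.
by apply/funext => j; rewrite mulr0 add0r mul1r.
Qed.

Lemma form_polar_delta v m : form_dom a E v ->
  form_polar E (delta_seq m) v = discrete_flux 1 1 m v.
Proof.
move=> vd; have [_ E1] := trace_form_perturbE m 1 vd (expr1n _ 2).
have m1 : (-1 : R) ^+ 2 = 1 by rewrite sqrrN expr1n.
have [_ E2] := trace_form_perturbE m 1 vd m1.
rewrite /form_polar.
have -> : (fun k => delta_seq m k + v k) = (fun j => 1 * v j + 1 * delta_seq m j).
  by apply/funext => j; ring.
have -> : (fun k => delta_seq m k - v k) = (fun j => -1 * v j + 1 * delta_seq m j).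
  by apply/funext => j; ring.
by rewrite E1 E2; field.
Qed.

(** The image of [delta_seq m] under the nonnegative operator of the form, which is
minus the generator of the semigroup. *)
Definition generator_seq m : nat -> R := fun j =>
  (2 * m.+1%:R ^+ 2 * delta_seq m j - m.+1%:R * m%:R * delta_seq m.-1 j
   - m.+1%:R * m.+2%:R * delta_seq m.+1 j) / a j.

Lemma sum_delta_seq (x : nat -> R) m n : (m < n)%N ->
  \sum_(0 <= j < n) delta_seq m j * x j = x m.
Proof.
move=> mn; rewrite (bigD1_seq m)/= ?mem_index_iota ?iota_uniq//.
rewrite /delta_seq eqxx mul1r big1 ?addr0// => j /negbTE ->.
by rewrite mul0r.
Qed.

Lemma l2inner_generator v m : l2inner a (generator_seq m) v = discrete_flux 1 1 m v.
Proof.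
apply/cvg_lim => //.
apply: cvg_near_cst; near=> n; rewrite /series/=.
have mn : (m.+2 <= n)%N by near: n; exists m.+2.
have -> : \sum_(0 <= k < n) a k * generator_seq m k * v k =
    2 * m.+1%:R ^+ 2 * (\sum_(0 <= k < n) delta_seq m k * v k)
    - m.+1%:R * m%:R * (\sum_(0 <= k < n) delta_seq m.-1 k * v k)
    - m.+1%:R * m.+2%:R * (\sum_(0 <= k < n) delta_seq m.+1 k * v k).
  rewrite !mulr_sumr -!sumrB; apply: eq_bigr => k _.
  by rewrite /generator_seq; field; rewrite gt_eqF.
have m0n : (m < n)%N by rewrite (leq_trans _ mn).
have m1n : (m.-1 < n)%N by rewrite (leq_ltn_trans (leq_pred _) m0n).
by rewrite !sum_delta_seq// /discrete_flux !mulr1.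
Unshelve. all: by end_near. Qed.

Lemma l2_generator m : l2 a (generator_seq m).
Proof.
apply: (@l2_finite_support _ _ ha _ m.+2) => k mk.
have d j : (j <= m.+1)%N -> delta_seq j k = 0 :> R.
  by move=> jm; rewrite /delta_seq gtn_eqF// (leq_ltn_trans jm).
by rewrite /generator_seq !d ?(leq_trans (leq_pred _))// !mulr0 !subr0 mul0r.
Qed.

(** Let Y be invariant and contain exactly one of k and k + 1, and let f be the
unit sequence at k + 1.  Then T t f vanishes at k for all t, hence so does the
limit of (f - T t f) / t as t tends to 0.  But this limit is [generator_seq], which
does not. *)
Lemma trace_irreducible : irreducible_form a E.
Proof.
move=> T [_ Tlin _ _ Tgen] Y invY; apply: contrapT => /not_orP[Y0 YT].
have [k Yk] : exists k, ~ (Y k <-> Y k.+1).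
  apply: contrapT => /forallNP YY; have {}YY k : Y k <-> Y k.+1.
    by have /contrapT := YY k.
  have Yall k : Y k <-> Y 0%N by elim: k => // k ih; rewrite -YY.
  have [y0|y0] := pselect (Y 0%N).
    by apply: YT; apply/seteqP; split=> // k _; exact/Yall.
  by apply: Y0; apply/seteqP; split=> // k /Yall.
pose m := k.+1; pose f : nat -> R := delta_seq m; pose g := generator_seq m.
have fl : l2 a f by exact: l2_delta.
have gl : l2 a g by exact: l2_generator.
have zl : l2 a (fun _ => 0) by have [] := form_dom_0.
have gen : l2sq a (fun k => (f k - T t f k) / t - g k) @[t --> 0^'+] --> 0%E.
  apply: (Tgen f g fl gl).2; split; first exact: form_dom_delta.
  by move=> v vd; rewrite form_polar_delta// l2inner_generator.
have fk : f k = 0 by rewrite /f /delta_seq ltn_eqF.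
have T0 t : 0 < t -> T t (fun _ => 0) = (fun _ => 0).
  move=> t0; have := Tlin t 1 _ _ t0 zl zl.
  rewrite (_ : (fun k => 1 * 0 + 0) = (fun _ => 0)); last first.
    by apply/funext => j; rewrite mulr0 addr0.
  move=> H; apply/funext => j; have := congr1 (@^~ j) H => /=; lra.
have Tfk t : 0 < t -> T t f k = 0.
  move=> t0; have inv := invY t f t0 fl.
  have [Yk'|Yk'] := pselect (Y k).
    have nYm : ~ Y m by move=> Ym; apply: Yk.
    have E0 : (fun k => \1_Y k * f k) = (fun _ => 0).
      apply/funext => j; rewrite /f /delta_seq; have [->|] := eqVneq j m.
        by rewrite indicE memNset// mul0r.
      by rewrite mulr0.
    have := congr1 (@^~ k) inv; rewrite E0 T0//= indicE mem_set// mul1r => <-//.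
  have Ym : Y m by apply: contrapT => nYm; apply: Yk.
  have E0 : (fun k => \1_Y k * f k) = f.
    apply/funext => j; rewrite /f /delta_seq; have [->|] := eqVneq j m.
      by rewrite indicE mem_set// mul1r.
    by rewrite mulr0.
  by have := congr1 (@^~ k) inv; rewrite E0 /= indicE memNset// mul0r.
have gk : g k != 0.
  rewrite /g /generator_seq /m /delta_seq /= eqxx ltn_eqF// ltn_eqF//.
  by rewrite !mulr0 mulr1 sub0r subr0 mulf_neq0 ?invr_eq0 ?oppr_eq0 ?mulf_neq0 ?pnatr_eq0 ?gt_eqF.
have pos : 0 < a k * g k ^+ 2 by rewrite mulr_gt0// exprn_even_gt0.
move/fine_cvgP : gen => [fin /cvgrPdist_lt/(_ _ pos) small].
near (0 : R)^'+ => t.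
have t0 : 0 < t by near: t; exact: nbhs_right_gt.
have tf : l2sq a (fun k => (f k - T t f k) / t - g k) \is a fin_num by near: t.
have : `|0 - fine (l2sq a (fun k => (f k - T t f k) / t - g k))| < a k * g k ^+ 2.
  by near: t.
rewrite sub0r normrN ltNge => /negP; apply.
apply: le_trans (ler_norm _); rewrite -lee_fin fineK//.
have := l2sq_term_le ha (fun k => (f k - T t f k) / t - g k) k.
by rewrite fk Tfk// subrr mul0r sub0r sqrrN.
Unshelve. all: by end_near. Qed.

(** Since |u k| <= sqrt (E u), it suffices that the a k * g k sum up to at most 1. *)
Lemma trace_transient : transient_form a E.
Proof.
pose q k : R := (2 ^ k.+1)%:R^-1; pose g k : R := q k / (1 + a k).
have q0 k : 0 < q k by rewrite invr_gt0 ltr0n expn_gt0.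
have q1 k : q k <= 1 by rewrite invf_le1 ?ltr0n ?ler1n expn_gt0.
have a1 k : 0 < 1 + a k by rewrite addr_gt0.
have g0 k : 0 < g k by rewrite divr_gt0.
have ag k : a k * g k <= q k.
  rewrite /g mulrA ler_pdivrMr// mulrC ler_wpM2l// ?lerDr//.
  exact: ltW.
exists g; split => //.
- exists 1 => k; rewrite ler_pdivrMr// mul1r (le_trans (q1 k))//.
  by rewrite lerDl ltW.
- apply: (@le_lt_trans _ _ (\sum_(0 <= k <oo) (1 / (2 ^ k.+1)%:R)%:E)%E).
    apply: lee_nneseries => [k _ _|k _]; rewrite lee_fin.
      by rewrite mulr_ge0 ?(ltW (ha k)) ?(ltW (g0 k)).
    by rewrite div1r ag.
  by apply: le_lt_trans (epsilon_trick0 xpredT ler01) _; rewrite ltry.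
- move=> u ud; have fu := form_dom_fin ud; set e := Num.sqrt _.
  have ue k : `|u k| <= e.
    by rewrite /e -sqrtr_sqr ler_wsqrtr// form_dom_sq.
  apply: le_trans (epsilon_trick0 xpredT (sqrtr_ge0 _ : 0 <= e)).
  apply: lee_nneseries => [k _ _|k _]; rewrite lee_fin.
    by rewrite mulr_ge0 ?(ltW (ha k))// mulr_ge0 ?(ltW (g0 k)).
  rewrite mulrCA ler_pM ?ag//.
  by rewrite mulr_ge0 ?(ltW (ha k)) ?(ltW (g0 k)).
Qed.

End TraceForm.

Theorem theorem3p6 (R : realType) (a : nat -> R) (ha : forall k, 0 < a k)
    (E : (nat -> R) -> \bar R) (hE : is_trace_form a E) :
  irreducible_form a E /\ transient_form a E.
Proof. by split; [exact: trace_irreducible|exact: trace_transient]. Qed.
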